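(* Assume conditions (C1), (C2), (C3) listed in the context, with $\nu\in[0,\infty)$ the constant appearing in (C2), and assume that for some $K\in\mathbb{N}$ there are $\lambda_1,\ldots,\lambda_K\in[0,\infty)$ such that \[ \lim_{n\to\infty}\frac{m_{n,k}}{k!\,(1-\overline{f}_n)}=\lambda_k,\quad k=1,2,\ldots,K,\qquad\text{and}\qquad \lambda_K=0 . \] Then the Galton--Watson process in varying environment with immigration $(Y_n)$ satisfies $Y_n\to Y$ in distribution as $n\to\infty$, where the random variable $Y$ has a compound-Poisson distribution with generating function, for $s\in[0,1]$, \[ f_Y(s)=\exp\left\{-\sum_{k=1}^{K-1}\frac{2^k\lambda_k}{\nu^k}\left(\log\left(1+\frac{\nu}{2}(1-s)\right)+\sum_{i=1}^{k-1}(-1)^i\frac{\nu^i}{i\,2^i}(1-s)^i\right)\right\}, \] where for $\nu=0$ each summand is understood as its limit as $\nu\downarrow0$, i.e. $f_Y(s)=\exp\left\{\sum_{k=1}^{K-1}(-1)^k\frac{\lambda_k}{k}(1-s)^k\right\}$.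
   Context: Let $\mathbb{N}=\{1,2,\ldots\}$. Let $\{\xi_{n,j},\varepsilon_n\}_{n,j\in\mathbb{N}}$ be independent nonnegative integer-valued random variables such that for each $n$ the variables $\xi_n,\xi_{n,1},\xi_{n,2},\ldots$ are identically distributed. Define $Y_0=0$ and $Y_n=\sum_{j=1}^{Y_{n-1}}\xi_{n,j}+\varepsilon_n$ for $n\in\mathbb{N}$. Let $f_n(s)=\mathbf{E}\,s^{\xi_n}$, $s\in[0,1]$, be the offspring generating function of generation $n$, and $\overline{f}_n=f_n'(1)=\mathbf{E}\,\xi_n$; $f_n''(1)=\mathbf{E}[\xi_n(\xi_n-1)]$ and $f_n'''(1)=\mathbf{E}[\xi_n(\xi_n-1)(\xi_n-2)]$. The factorial moments of the immigration are $m_{n,k}=\mathbf{E}[\varepsilon_n(\varepsilon_n-1)\cdots(\varepsilon_n-k+1)]$, $k\in\mathbb{N}$. Conditions: (C1) $\overline{f}_n<1$ for all $n$, $\lim_{n\to\infty}\overline{f}_n=1$, and $\sum_{n=1}^\infty(1-\overline{f}_n)=\infty$. (C2) $\lim_{n\to\infty}\frac{f_n''(1)}{1-\overline{f}_n}=\nu\in[0,\infty)$. (C3) if $\nu>0$, then $\lim_{n\to\infty}\frac{f_n'''(1)}{1-\overline{f}_n}=0$. A random variable $Y$ has a compound-Poisson distribution if it has the law of $\sum_{i=1}^N Z_i$, where $Z_1,Z_2,\ldots$ are iid nonnegative integer-valued and $N$ is Poisson distributed (parameter $0$ allowed) and independent of $(Z_i)$. Its generating function is $f_Y(s)=\mathbf{E}\,s^Y$.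 Empty sums are $0$. *)

(* Defs.v *)
From HB Require Import structures.
From mathcomp Require Import all_boot all_order all_algebra.
From mathcomp Require Import all_classical all_reals all_analysis.

Set Implicit Arguments.
Unset Strict Implicit.
Unset Printing Implicit Defensive.

Import Order.TTheory GRing.Theory Num.Theory.
Import numFieldNormedType.Exports.

Local Open Scope classical_set_scope.
Local Open Scope ring_scope.

Definition mutually_independent d (T : measurableType d) (R : realType)
    (P : probability T R) d' (T' : measurableType d') (I : choiceType)
    (X : I -> {RV P >-> T'}) : Prop :=
  forall (J : seq I) (A : I -> set T'),
    uniq J -> (forall i, measurable (A i)) ->
    P (\bigcap_(i in [set` J]) (X i @^-1` A i)) =
      (\prod_(i <- J) P (X i @^-1` A i))%E.

(* Stated for plain functions, so that random sums need not be bundled as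
   random variables first. *)
Definition same_law d1 (T1 : measurableType d1) d2 (T2 : measurableType d2)
    (R : realType) (P1 : probability T1 R) (P2 : probability T2 R)
    d' (T' : measurableType d') (X1 : T1 -> T') (X2 : T2 -> T') : Prop :=
  forall A : set T', measurable A -> P1 (X1 @^-1` A) = P2 (X2 @^-1` A).

Definition cvg_in_distribution d (T : measurableType d) d' (T' : measurableType d')
    (R : realType) (P : probability T R) (P' : probability T' R)
    (X : nat -> T -> R) (X' : T' -> R) : Prop :=
  forall g : R -> R, continuous g -> [bounded g x | x in [set: R]] ->
    ('E_P[fun w => g (X n w)] @[n --> \oo] --> 'E_P'[fun w => g (X' w)])%E.

(* E[X (X - 1) ... (X - k + 1)], possibly +oo. *)
Definition factorial_moment d (T : measurableType d) (R : realType)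
    (P : probability T R) (X : T -> nat) (k : nat) : \bar R :=
  ('E_P[(fun w => (X w ^_ k)%:R)%R])%E.

Definition mean d (T : measurableType d) (R : realType)
    (P : probability T R) (X : T -> nat) : \bar R :=
  ('E_P[(fun w => (X w)%:R)%R])%E.

Definition pgf d (T : measurableType d) (R : realType)
    (P : probability T R) (X : T -> nat) (s : R) : \bar R :=
  ('E_P[(fun w => s ^+ X w)%R])%E.

(* Indices are shifted by one: xi n j is the offspring number of individual
   j + 1 in the reproduction step leading to generation n + 1, and eps n is the
   immigration into generation n + 1. *)
Definition offspring_immigration d (T : measurableType d) (R : realType)
    (P : probability T R) (xi : nat -> nat -> {RV P >-> nat})
    (eps : nat -> {RV P >-> nat}) (i : (nat * nat) + nat) : {RV P >-> nat} :=
  match i with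
  | inl nj => xi nj.1 nj.2
  | inr n => eps n
  end.

Fixpoint gw_process d (T : measurableType d) (R : realType)
    (P : probability T R) (xi : nat -> nat -> {RV P >-> nat})
    (eps : nat -> {RV P >-> nat}) (n : nat) (w : T) : nat :=
  if n is m.+1 then (\sum_(j < gw_process xi eps m w) xi m j w + eps m w)%N
  else 0%N.

(* The second argument of [poisson_prob] is unused, and for rate 0 it is the
   Dirac mass at 0. Indexing the joint family by [option nat] makes the Z i
   independent of each other and N independent of all of them. *)
Definition compound_poisson d (T : measurableType d) (R : realType)
    (P : probability T R) (Y : T -> nat) : Prop :=
  exists (d' : measure_display) (T' : measurableType d')
    (Q : probability T' R) (Z : nat -> {RV Q >-> nat}) (N : {RV Q >-> nat})
    (rate : R),
    [/\ 0 <= rate,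
        (forall A : set nat, distribution Q N A = poisson_prob rate 0 A),
        (forall i, same_law Q Q (Z i) (Z 0%N)),
        mutually_independent (fun i : option nat => if i is Some j then Z j else N)
      & same_law P Q Y (fun w => (\sum_(i < N w) Z i w)%N)].

Definition limit_pgf (R : realType) (nu : R) (K : nat) (lambda : nat -> R)
    (s : R) : R :=
  if nu == 0 then
    expR (\sum_(1 <= k < K) (-1) ^+ k * (lambda k / k%:R) * (1 - s) ^+ k)
  else
    expR (- \sum_(1 <= k < K) (2 ^+ k * lambda k / nu ^+ k) *
      (ln (1 + nu / 2 * (1 - s)) +
       \sum_(1 <= i < k)
         (-1) ^+ i * (nu ^+ i / (i%:R * 2 ^+ i)) * (1 - s) ^+ i)).

(* Main.v *)
(* Work with x = 1 - s and put a_n = 1 - E xi_n. The limit G(s) = F(1 - s) is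
   characterised by (log F)'(x) = q(x) / (1 + nu x / 2), F(0) = 1, where
   q(x) = sum_(1 <= k < K) (-1)^k lambda_k x^(k-1). By the Bonferroni
   inequalities, (C2), (C3) and the moment conditions,
     1 - f_n(1 - x) = x - a_n (x + nu x^2 / 2) + o(a_n x),
     E (1 - x)^(eps_n) = 1 + a_n x q(x) + o(a_n x)
   uniformly in x, so that F is almost invariant under the recursion
   G_n(s) = G_(n-1)(f_n(s)) E s^(eps_n) satisfied by the generating functions
   G_n of Y_n, with error o(a_n x). As 1 - f_n(1 - x) <= (1 - a_n) x, each step
   multiplies the part of |G_n(1 - x) - F(x)| that is linear in x by 1 - a_n,
   and prod (1 - a_n) = 0 forces uniform convergence.

   The limit is compound Poisson because log G has nonnegative power series
   coefficients in s (except the constant one): - q(1 - s) is a polynomial in s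
   with nonnegative coefficients, being a limit of tails of eps_n divided by
   a_n, and 1 / (1 + nu (1 - s) / 2) is a geometric series. The independent
   variables of the compound Poisson law are read off a uniform point of
   [0, 1) by iterated, variable-base digit expansion. *)
Require Import Defs.
From HB Require Import structures.
From mathcomp Require Import all_boot all_order all_algebra.
From mathcomp Require Import all_classical all_reals all_analysis.
From mathcomp Require Import measurable_realfun.
From mathcomp Require Import ring lra.

Set Implicit Arguments.
Unset Strict Implicit.
Unset Printing Implicit Defensive.

Import Order.TTheory GRing.Theory Num.Theory.
Import numFieldNormedType.Exports.

Local Open Scope classical_set_scope.
Local Open Scope ring_scope.

(** * Bonferroni inequalities and Lipschitz functions on [0, 1] *)

(** The errors must be o(a_n x), not merely o(a_n): one step turns a linear coefficient
    [D * pr + e1] into [(D * pr + e1) * (1 - a_n) + e1 * a_n], so a single [e1] absorbs all errors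
    although the a_n sum to infinity. The bound also carries a constant term, because the factorial
    moments of eps_n are finite only eventually and the generating function of the starting
    generation may have infinite slope at s = 1; the factor E s^(eps_n) <= 1 never enlarges that
    constant. The condition lambda_K = 0 acts twice: it makes the Bonferroni remainder of order K
    negligible against a_n in the expansion of E s^(eps_n), and likewise in that of P(eps_n = i),
    which fixes the sign of the jump rates. The recursion for G_n rests on the independence of
    Y_(n-1) from the n-th reproduction and immigration step; it is expressed by integrals of
    products over the events Y_(n-1) = k, without sigma-algebras. The limit law is built explicitly,
    so no compactness argument occurs: convergence of generating functions yields convergence of
    point masses, and no mass escapes because the limit masses sum to 1. *)

Lemma bonferroni (R : realDomainType) (x : R) (n K : nat) : 0 <= x <= 1 ->
  0 <= (-1) ^+ K * ((1 - x) ^+ n - \sum_(0 <= k < K) (-1) ^+ k * 'C(n, k)%:R * x ^+ k)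
    <= 'C(n, K)%:R * x ^+ K.
Proof.
move=> /andP[x0 x1]; elim: n K => [|n IHn] [|K].
- by rewrite big_geq// bin0 !expr0 subr0 !mul1r ler01 lexx.
- rewrite big_nat_recl// bin0 !expr0 !mul1r big1 ?addr0 ?subrr ?mulr0.
    by rewrite lexx mulr_ge0// exprn_ge0.
  by move=> i _; rewrite bin_small// mulr0 mul0r.
- rewrite big_geq// bin0 !expr0 subr0 !mul1r exprn_ge0 ?subr_ge0//=.
  by rewrite exprn_ile1// ?subr_ge0// lerBlDl lerDr.
pose E m k := (1 - x) ^+ m -
  \sum_(0 <= i < k) (-1) ^+ i * 'C(m, i)%:R * x ^+ i.
(* Pascal's rule. As the sign [(-1) ^+ K] alternates, the signed remainder becomes a sum of two
   nonnegative ones, so induction on [n] with [K] general closes. *)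
have rec : E n.+1 K.+1 = E n K.+1 - x * E n K.
  rewrite /E ![\sum_(0 <= k < K.+1) _]big_nat_recl// !bin0.
  under eq_bigr => i _.
    rewrite binS natrD (_ : _ * _ * _ = (-1) ^+ i.+1 * 'C(n, i.+1)%:R * x ^+ i.+1
      - x * ((-1) ^+ i * 'C(n, i)%:R * x ^+ i)); last by rewrite !exprS; ring.
    over.
  by rewrite sumrB -mulr_sumr exprS; ring.
have /andP[l1 u1] := IHn K.+1; have /andP[l2 u2] := IHn K.
rewrite -/(E n K.+1) in l1 u1; rewrite -/(E n K) in l2 u2.
rewrite -/(E n.+1 K.+1) rec.
have -> : (-1) ^+ K.+1 * (E n K.+1 - x * E n K) =
    (-1) ^+ K.+1 * E n K.+1 + x * ((-1) ^+ K * E n K) by rewrite exprS; ring.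
apply/andP; split; first exact/addr_ge0/mulr_ge0.
rewrite binS natrD mulrDl; apply: lerD => //.
by rewrite exprS [leRHS]mulrCA ler_wpM2l.
Qed.

Lemma bonferroni_norm (R : realDomainType) (x : R) (n K : nat) : 0 <= x <= 1 ->
  `|(1 - x) ^+ n - \sum_(0 <= k < K) (-1) ^+ k * 'C(n, k)%:R * x ^+ k|
    <= 'C(n, K)%:R * x ^+ K.
Proof.
by move=> /(@bonferroni _ _ n K)/andP[/ger0_norm]; rewrite normrMsign => ->.
Qed.

(** Boundedness and the Lipschitz property are kept together because products and inverses preserve
    the second only in presence of the first. *)
Definition bounded_lipschitz01 (R : realType) (g : R -> R) : Prop :=
  exists2 C : R, 0 <= C &
    forall x y : R, 0 <= x <= 1 -> 0 <= y <= 1 ->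
      `|g x| <= C /\ `|g x - g y| <= C * `|x - y|.

Section bounded_lipschitz01.
Variable R : realType.
Implicit Types g h : R -> R.

Lemma bounded_lipschitz01_cst (c : R) : bounded_lipschitz01 (fun=> c).
Proof.
by exists `|c| => // x y _ _; rewrite lexx subrr normr0 mulr_ge0.
Qed.

Lemma bounded_lipschitz01_id : bounded_lipschitz01 (fun x : R => x).
Proof.
exists 1 => // x y /andP[x0 x1] _.
by rewrite mul1r lexx ger0_norm.
Qed.

Lemma bounded_lipschitz01D g h : bounded_lipschitz01 g ->
  bounded_lipschitz01 h -> bounded_lipschitz01 (fun x => g x + h x).
Proof.
move=> [C C0 gC] [D D0 hD]; exists (C + D); first exact: addr_ge0.
move=> x y x01 y01; have [g1 g2] := gC x y x01 y01.
have [h1 h2] := hD x y x01 y01; split.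
  by rewrite (le_trans (ler_normD _ _))// lerD.
rewrite [X in `|X|](_ : _ = (g x - g y) + (h x - h y)); last by ring.
by rewrite (le_trans (ler_normD _ _))// mulrDl lerD.
Qed.

Lemma bounded_lipschitz01M g h : bounded_lipschitz01 g ->
  bounded_lipschitz01 h -> bounded_lipschitz01 (fun x => g x * h x).
Proof.
move=> [C C0 gC] [D D0 hD]; exists (C * D + C * D).
  by rewrite addr_ge0 ?mulr_ge0.
move=> x y x01 y01; have [g1 g2] := gC x y x01 y01.
have [h1 h2] := hD x y x01 y01; have [g3 _] := gC y x y01 x01.
split.
  by rewrite normrM (le_trans (ler_pM _ _ g1 h1))// lerDl mulr_ge0.
rewrite [X in `|X|](_ : _ = (g x - g y) * h x + g y * (h x - h y)); last by ring.
rewrite (le_trans (ler_normD _ _))// !normrM mulrDl lerD//.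
  by rewrite -mulrA [D * _]mulrC mulrA; exact: ler_pM.
by rewrite -mulrA; exact: ler_pM.
Qed.

Lemma bounded_lipschitz01_exp g n : bounded_lipschitz01 g ->
  bounded_lipschitz01 (fun x => g x ^+ n).
Proof.
move=> lg; elim: n => [|n IHn].
  under eq_fun do rewrite expr0; exact: bounded_lipschitz01_cst.
by under eq_fun do rewrite exprS; exact: bounded_lipschitz01M.
Qed.

Lemma bounded_lipschitz01_sum (I : Type) (r : seq I) (G : I -> R -> R) :
  (forall i, bounded_lipschitz01 (G i)) ->
  bounded_lipschitz01 (fun x => \sum_(i <- r) G i x).
Proof.
move=> lG; elim: r => [|i r IHr].
  under eq_fun do rewrite big_nil; exact: bounded_lipschitz01_cst.
by under eq_fun do rewrite big_cons; exact: bounded_lipschitz01D.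
Qed.

Lemma bounded_lipschitz01_inv g : bounded_lipschitz01 g ->
  (forall x : R, 0 <= x <= 1 -> 1 <= g x) ->
  bounded_lipschitz01 (fun x => (g x)^-1).
Proof.
move=> [C C0 gC] g1; exists (C + 1); first by rewrite addr_ge0.
have gi (x : R) : 0 <= x <= 1 -> 0 < (g x)^-1 <= 1.
  move=> /g1 gx1; have gx0 : 0 < g x by exact: lt_le_trans gx1.
  by rewrite invr_gt0 gx0 invf_le1.
move=> x y x01 y01; have [_ g2] := gC x y x01 y01.
have /andP[ix0 ix1] := gi x x01; have /andP[iy0 iy1] := gi y y01; split.
  by rewrite gtr0_norm// (le_trans ix1)// lerDr.
have gx0 : g x != 0 by rewrite gt_eqF// -invr_gt0.
have gy0 : g y != 0 by rewrite gt_eqF// -invr_gt0.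
rewrite [X in `|X|](_ : _ = - ((g x)^-1 * (g y)^-1 * (g x - g y))); last first.
  by field; rewrite gx0 gy0.
rewrite normrN !normrM (gtr0_norm ix0) (gtr0_norm iy0).
apply: (@le_trans _ _ (1 * `|g x - g y|)).
  by rewrite ler_wpM2r// mulr_ile1// ltW.
by rewrite mul1r (le_trans g2)// ler_wpM2r// lerDl.
Qed.

Lemma bounded_lipschitz01_derive g (g' : R -> R) :
  (forall x : R, 0 <= x <= 1 -> is_derive x 1 g (g' x)) ->
  (exists2 C : R, 0 <= C & forall x : R, 0 <= x <= 1 -> `|g' x| <= C) ->
  bounded_lipschitz01 g.
Proof.
move=> dg [C C0 g'C].
have lip (x y : R) : 0 <= x <= 1 -> 0 <= y <= 1 -> `|g x - g y| <= C * `|x - y|.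
  wlog xy : x y / y <= x => [hw|/andP[x0 x1] /andP[y0 y1]].
    have [|/ltW xy x01 y01] := leP y x; first exact: hw.
    by rewrite distrC [`|x - y|]distrC hw.
  have sub (z : R) : z \in `[y, x] -> 0 <= z <= 1.
    by rewrite in_itv/= => /andP[yz zx]; rewrite (le_trans y0)// (le_trans zx).
  have [||z zin ->] := @MVT_segment R g g' y x xy.
  - by move=> z zyx; apply/dg/sub; exact: subset_itv_oo_cc zyx.
  - apply: derivable_within_continuous => z /sub/dg H.
    exact: ex_derive.
  by rewrite normrM ler_wpM2r// g'C// sub.
exists (C + `|g 0|); first by rewrite addr_ge0.
move=> x y x01 y01; split; last first.
  by rewrite (le_trans (lip x y x01 y01))// ler_wpM2r// lerDl.
have := lip x 0 x01; rewrite lexx ler01 subr0 => /(_ isT) l0.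
rewrite -[g x](subrK (g 0)) (le_trans (ler_normD _ _))// lerD2r (le_trans l0)//.
by case/andP: x01 => x0 x1; rewrite ger0_norm// ler_piMr.
Qed.

End bounded_lipschitz01.

(** * The logarithm of the limit generating function *)

Section log_limit_pgf.
Variable R : realType.
Variables (nu : R) (K : nat) (lambda : nat -> R).

Definition log_limit_pgf (x : R) : R :=
  if nu == 0 then \sum_(1 <= k < K) (-1) ^+ k * (lambda k / k%:R) * x ^+ k
  else - \sum_(1 <= k < K) (2 ^+ k * lambda k / nu ^+ k) *
      (ln (1 + nu / 2 * x) +
       \sum_(1 <= i < k) (-1) ^+ i * (nu ^+ i / (i%:R * 2 ^+ i)) * x ^+ i).

Lemma limit_pgfE s : limit_pgf nu K lambda s = expR (log_limit_pgf (1 - s)).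
Proof. by rewrite /limit_pgf /log_limit_pgf; case: ifP. Qed.

(** The polynomial q of the overview; [dlog_limit_pgf] below is the quotient (log F)'. *)
Definition immigration_slope (x : R) : R :=
  \sum_(1 <= k < K) (-1) ^+ k * lambda k * x ^+ k.-1.

Definition dlog_limit_pgf (x : R) : R := immigration_slope x / (1 + nu / 2 * x).

Lemma is_derive_bigsum (I : eqType) (r : seq I) (f : I -> R -> R) (df : I -> R) (x : R) :
  (forall i, i \in r -> is_derive x 1 (f i) (df i)) ->
  is_derive x 1 (fun y => \sum_(i <- r) f i y) (\sum_(i <- r) df i).
Proof.
elim: r => [|i r IHr] fdf.
  rewrite big_nil; under eq_fun do rewrite big_nil.
  exact: is_derive_cst.
rewrite big_cons; under eq_fun do rewrite big_cons.
apply: is_deriveD; first by apply: fdf; rewrite mem_head.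
by apply: IHr => j jr; apply: fdf; rewrite inE jr orbT.
Qed.

Lemma is_derive_scaled_exp (c : R) (k : nat) (x : R) :
  is_derive x 1 (fun y : R => c * y ^+ k) (c * (k%:R * x ^+ k.-1)).
Proof.
have := @is_deriveX R R id k x 1 1 (is_derive_id x 1).
move=> /(@is_deriveZ _ _ _ _ c).
rewrite /GRing.scale/= mulr1; congr is_derive.
by rewrite exprfctE.
Qed.

Hypothesis nu_ge0 : 0 <= nu.

Let denom_gt0 (x : R) : 0 <= x -> 0 < 1 + nu / 2 * x.
Proof. by move=> x0; rewrite ltr_pwDl// mulr_ge0// divr_ge0. Qed.

(** With y = nu x / 2 the function is log(1 + y) minus its Taylor polynomial of degree [k]; its
    derivative in y is 1 / (1 + y) minus a geometric partial sum, that is (-y)^k / (1 + y). *)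
Lemma is_derive_log_block (k : nat) (x : R) : 0 <= x ->
  is_derive x 1
    (fun x : R => ln (1 + nu / 2 * x) +
       \sum_(1 <= i < k.+1) (-1) ^+ i * (nu ^+ i / (i%:R * 2 ^+ i)) * x ^+ i)
    (nu / 2 * (- (nu / 2 * x)) ^+ k / (1 + nu / 2 * x)).
Proof.
move=> x0; elim: k => [|k IHk].
  under eq_fun do rewrite big_geq// addr0.
  rewrite expr0 mulr1.
  have dl : is_derive x 1 (fun y : R => 1 + nu / 2 * y) (nu / 2).
    have := @is_derive_scaled_exp (nu / 2) 1 x.
    rewrite /= expr0 !mulr1 => H.
    have := is_deriveD (is_derive_cst (1 : R) x (1 : R)) H.
    by rewrite add0r.
  have := @is_derive1_comp R (@ln R) (fun y => 1 + nu / 2 * y) x _ _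
    (is_derive1_ln (denom_gt0 x0)) dl.
  by rewrite [_^-1 * _]mulrC.
under eq_fun do rewrite big_nat_recr//= addrA.
have dsum := is_deriveD IHk (@is_derive_scaled_exp
  ((-1) ^+ k.+1 * (nu ^+ k.+1 / (k.+1%:R * 2 ^+ k.+1))) k.+1 x).
apply: (is_derive_eq dsum).
rewrite /= !exprS (exprNn (nu / 2 * x)) !exprMn exprVn; field.
have d0 : 2 + nu * x != 0 by rewrite gt_eqF// ltr_pwDl// mulr_ge0.
by rewrite d0 expf_neq0// nat1r pnatr_eq0.
Qed.

(** The factors 2^k / nu^k cancel against those of the block derivative, so both branches of
    [log_limit_pgf] have the same derivative formula and nu = 0 needs no separate treatment in the
    analysis of F. *)
Lemma is_derive_log_limit_pgf (x : R) : 0 <= x ->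
  is_derive x 1 log_limit_pgf (dlog_limit_pgf x).
Proof.
move=> x0; rewrite /log_limit_pgf /dlog_limit_pgf /immigration_slope.
have [nu0|nu0] := eqVneq nu 0.
  rewrite nu0 !mul0r addr0 divr1.
  apply: is_derive_bigsum => k; rewrite mem_index_iota => /andP[k1 _].
  have := @is_derive_scaled_exp ((-1) ^+ k * (lambda k / k%:R)) k x.
  by congr is_derive; field; rewrite pnatr_eq0 -lt0n.
rewrite mulr_suml; under eq_fun do rewrite -sumrN.
pose block k (y : R) := ln (1 + nu / 2 * y) +
  \sum_(1 <= i < k) (-1) ^+ i * (nu ^+ i / (i%:R * 2 ^+ i)) * y ^+ i.
apply: (@is_derive_bigsum _ _ (fun k y => - (2 ^+ k * lambda k / nu ^+ k * block k y))).
move=> [|k] kr; first by rewrite mem_index_iota in kr.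
under eq_fun do rewrite -mulNr.
have dblock := is_deriveZ (- (2 ^+ k.+1 * lambda k.+1 / nu ^+ k.+1))
  (is_derive_log_block k x0).
apply: (is_derive_eq dblock).
rewrite /GRing.scale/= (exprNn (nu / 2 * x)) !exprMn exprVn !exprS; field.
have d0 : 2 + nu * x != 0 by rewrite gt_eqF// ltr_pwDl// mulr_ge0.
by rewrite d0 nu0 !expf_neq0.
Qed.

Lemma log_limit_pgf0 : log_limit_pgf 0 = 0.
Proof.
rewrite /log_limit_pgf; case: ifP => _.
  by rewrite big_nat big1// => -[|k] //= _; rewrite (expr0n _ _.+1) mulr0.
rewrite big_nat big1 ?oppr0// => k _.
rewrite mulr0 addr0 ln1 add0r big_nat big1 ?mulr0// => -[|i] //= _.
by rewrite (expr0n _ _.+1) mulr0.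
Qed.

Lemma bounded_lipschitz01_immigration_slope : bounded_lipschitz01 immigration_slope.
Proof.
apply: bounded_lipschitz01_sum => k; apply: bounded_lipschitz01M.
  exact: bounded_lipschitz01_cst.
exact/bounded_lipschitz01_exp/bounded_lipschitz01_id.
Qed.

Lemma bounded_lipschitz01_dlog_limit_pgf : bounded_lipschitz01 dlog_limit_pgf.
Proof.
apply: bounded_lipschitz01M; first exact: bounded_lipschitz01_immigration_slope.
apply: bounded_lipschitz01_inv.
  apply: bounded_lipschitz01D; first exact: bounded_lipschitz01_cst.
  apply: bounded_lipschitz01M; first exact: bounded_lipschitz01_cst.
  exact: bounded_lipschitz01_id.
by move=> x /andP[x0 _]; rewrite lerDl mulr_ge0// divr_ge0.
Qed.

(** The function F of the overview. *)
Definition limit_pgf_compl (x : R) : R := expR (log_limit_pgf x).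

Lemma is_derive_limit_pgf_compl (x : R) : 0 <= x ->
  is_derive x 1 limit_pgf_compl (limit_pgf_compl x * dlog_limit_pgf x).
Proof.
move=> x0.
exact: (is_derive1_comp (is_derive_expR _) (is_derive_log_limit_pgf x0)).
Qed.

Lemma bounded_lipschitz01_limit_pgf_compl : bounded_lipschitz01 limit_pgf_compl.
Proof.
have [D D0 dD] := bounded_lipschitz01_dlog_limit_pgf.
have [C C0 LC] : bounded_lipschitz01 log_limit_pgf.
  apply: (@bounded_lipschitz01_derive _ _ dlog_limit_pgf).
    by move=> x /andP[x0 _]; exact: is_derive_log_limit_pgf.
  by exists D => // x x01; have [] := dD x x x01 x01.
apply: (@bounded_lipschitz01_derive _ _
    (fun x => limit_pgf_compl x * dlog_limit_pgf x)).
  by move=> x /andP[x0 _]; exact: is_derive_limit_pgf_compl.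
exists (expR C * D) => [|x x01]; first by rewrite mulr_ge0// expR_ge0.
have [Lx _] := LC x x x01 x01; have [dx _] := dD x x x01 x01.
rewrite normrM ler_pM// ger0_norm ?expR_ge0// ler_expR.
exact: le_trans (ler_norm _) Lx.
Qed.

(** A Lipschitz F' gives F a quadratic first-order Taylor remainder without a second derivative. *)
Lemma bounded_lipschitz01_dlimit_pgf_compl :
  bounded_lipschitz01 (fun x => limit_pgf_compl x * dlog_limit_pgf x).
Proof.
apply: bounded_lipschitz01M; first exact: bounded_lipschitz01_limit_pgf_compl.
exact: bounded_lipschitz01_dlog_limit_pgf.
Qed.

End log_limit_pgf.

(** * Convergence of the generating functions *)

Lemma mean_value01 (R : realType) (g g' : R -> R) (x y : R) :
  (forall z : R, 0 <= z <= 1 -> is_derive z 1 g (g' z)) ->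
  0 <= x <= 1 -> 0 <= y <= 1 ->
  exists z : R, [/\ 0 <= z <= 1, `|z - x| <= `|y - x| & g y - g x = g' z * (y - x)].
Proof.
move=> dg; have mvt (u v : R) : 0 <= u <= 1 -> 0 <= v <= 1 -> u <= v ->
    exists z : R, [/\ 0 <= z <= 1, u <= z <= v & g v - g u = g' z * (v - u)].
  move=> /andP[u0 u1] /andP[v0 v1] uv.
  have sub (z : R) : z \in `[u, v] -> 0 <= z <= 1.
    by rewrite in_itv/= => /andP[uz zv]; rewrite (le_trans u0)// (le_trans zv).
  have [||z zin ->] := @MVT_segment R g g' u v uv.
  - by move=> z zuv; apply/dg/sub; exact: subset_itv_oo_cc zuv.
  - apply: derivable_within_continuous => z /sub/dg H.
    exact: ex_derive.
  by exists z; split => //; exact: sub.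
move=> x01 y01; have [xy|/ltW yx] := leP x y.
  have [z [z01 /andP[xz zy] ->]] := mvt x y x01 y01 xy.
  exists z; split => //; rewrite !ger0_norm ?subr_ge0//.
  by rewrite lerB.
have [z [z01 /andP[yz zx] e]] := mvt y x y01 x01 yx.
exists z; split => //; last by rewrite -opprB e -mulrN opprB.
by rewrite !ler0_norm ?subr_le0// lerN2 lerB.
Qed.

Section convergence.
Variables (R : realType) (nu : R) (K : nat) (lambda : nat -> R).
Variables (a : nat -> R) (phi eta : nat -> R -> R).
Hypothesis nu_ge0 : 0 <= nu.
Hypothesis a_gt0 : forall n, 0 < a n.
Hypothesis a_le1 : forall n, a n <= 1.
Hypothesis phi_ge0 : forall n (x : R), 0 <= x <= 1 -> 0 <= phi n x.
Hypothesis phi_le : forall n (x : R), 0 <= x <= 1 -> phi n x <= (1 - a n) * x.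

Local Notation F := (limit_pgf_compl nu K lambda).
Local Notation q := (immigration_slope K lambda).

Let phi01 n (x : R) : 0 <= x <= 1 -> 0 <= phi n x <= 1.
Proof.
move=> /andP[x0 x1]; rewrite phi_ge0 ?x0//= (le_trans (phi_le _ _)) ?x0//.
by rewrite mulr_ile1// ?subr_ge0// gerBl ltW.
Qed.

(** Here [phi n x] stands for 1 - f_n(1 - x) and [eta n x] for E (1 - x)^(eps_n). The differential
    equation of F makes the first-order effects of [phi] and [eta] cancel; what is left is either of
    order a_n^2 x or one of the two assumed errors. *)
Lemma one_step_error :
  a @ \oo --> 0 ->
  (forall e : R, 0 < e -> \forall n \near \oo, forall x : R, 0 <= x <= 1 ->
    `|phi n x - x + a n * (x + nu / 2 * x ^+ 2)| <= e * (a n * x)) ->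
  (forall e : R, 0 < e -> \forall n \near \oo, forall x : R, 0 <= x <= 1 ->
    `|eta n x - 1 - a n * (x * q x)| <= e * (a n * x)) ->
  forall e : R, 0 < e -> \forall n \near \oo, forall x : R, 0 <= x <= 1 ->
    `|F (phi n x) * eta n x - F x| <= e * (a n * x).
Proof.
move=> a0 Hphi Heta e e0.
have [C C0 FC] := bounded_lipschitz01_limit_pgf_compl K lambda nu_ge0.
have [D D0 F'D] := bounded_lipschitz01_dlimit_pgf_compl K lambda nu_ge0.
have [Q Q0 qQ] := bounded_lipschitz01_immigration_slope K lambda.
set F' := (fun x => F x * dlog_limit_pgf nu K lambda x) in F'D.
(* With A = a_n x, the increment of [phi] is at most [B * A] and that of [eta] at most
   [(Q + 1) * A]; [W] collects the constants of the two second-order terms, and [e1] splits [e / 2]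
   between the two first-order errors, each weighted by at most [M]. *)
pose M := C + D + 1; pose B := 2 + nu.
have M0 : 0 < M by rewrite /M ltr_wpDl// addr_ge0.
have B0 : 0 < B by rewrite /B ltr_pwDl.
pose W := M * B * (Q + 1) + M * (B * B).
have W0 : 0 < W by rewrite addr_gt0 ?mulr_gt0// ltr_wpDl.
pose e1 := Num.min 1 (e / (4 * M)).
have e10 : 0 < e1 by rewrite lt_min ltr01 divr_gt0// mulr_gt0.
have e11 : e1 <= 1 by rewrite ge_min lexx.
have Me1 : 2 * M * e1 <= e / 2.
  rewrite (@le_trans _ _ (2 * M * (e / (4 * M))))//.
    by rewrite ler_pM2l ?mulr_gt0// ge_min lexx orbT.
  by rewrite le_eqVlt; apply/orP; left; apply/eqP; field; rewrite gt_eqF.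
have aW : \forall n \near \oo, W * a n <= e / 2.
  have : e / 2 / W > 0 by rewrite !divr_gt0.
  move/(cvgr0_norm_le _ a0); apply: filterS => n.
  by rewrite gtr0_norm// ler_pdivlMr// mulrC.
near=> n => x x01; have /andP[x0 x1] := x01.
have p01 := phi01 n x01.
have an0 := a_gt0 n.
have Hp : `|phi n x - x + a n * (x + nu / 2 * x ^+ 2)| <= e1 * (a n * x).
  move: x x01 {x0 x1 p01}; near: n; exact: Hphi.
have Hh : `|eta n x - 1 - a n * (x * q x)| <= e1 * (a n * x).
  move: x x01 {x0 x1 p01 Hp}; near: n; exact: Heta.
have Wn : W * a n <= e / 2 by near: n.
set p := phi n x in Hp p01 *; set h := eta n x in Hh *.
set A := a n * x in Hp Hh *.
have A0 : 0 <= A by rewrite mulr_ge0// ltW.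
have Aa : A <= a n by rewrite /A ler_piMr// ltW.
have px : `|p - x| <= B * A.
  rewrite [p - x](_ : _ = (p - x + a n * (x + nu / 2 * x ^+ 2)) -
    (1 + nu / 2 * x) * A); last by rewrite /A; ring.
  rewrite (le_trans (ler_normB _ _))//.
  have -> : B * A = 1 * A + (1 + nu) * A by rewrite /B; ring.
  rewrite lerD//; first by rewrite (le_trans Hp)// ler_wpM2r.
  have nx : 0 <= nu / 2 * x by rewrite !mulr_ge0.
  rewrite ger0_norm; last by rewrite mulr_ge0// addr_ge0.
  rewrite ler_wpM2r// lerD2l.
  by rewrite -mulrA ler_piMr// mulrC ler_pdivrMr// mul1r (le_trans x1)// ler1n.
have [q1 _] := qQ x x x01 x01.
have h1 : `|h - 1| <= (Q + 1) * A.
  rewrite [h - 1](_ : _ = (h - 1 - a n * (x * q x)) + q x * A); last first.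
    by rewrite /A; ring.
  rewrite (le_trans (ler_normD _ _))// [(Q + 1) * A]mulrDl addrC lerD//.
    by rewrite normrM (ger0_norm A0) ler_wpM2r.
  by rewrite (le_trans Hh)// ler_wpM2r.
have dF (z : R) : 0 <= z <= 1 -> is_derive z 1 F (F' z).
  by move=> /andP[z0 _]; exact: is_derive_limit_pgf_compl.
have [z [z01 zx FE]] := mean_value01 dF x01 p01.
have [F'z F'zx] := F'D z x z01 x01; have [F'x _] := F'D x x x01 x01.
have [Fx _] := FC x x x01 x01.
have CM : C <= M by rewrite /M -addrA lerDl addr_ge0.
have DM : D <= M by rewrite /M addrAC lerDr addr_ge0.
(* The equation (log F)' = q / (1 + nu x / 2), multiplied by F(x) x (1 + nu x / 2). *)
have key : F' x * (x + nu / 2 * x ^+ 2) = F x * (x * q x).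
  rewrite /F' /dlog_limit_pgf; field.
  by rewrite gt_eqF// ltr_pwDl// mulr_ge0.
have -> : F p * h - F x = (F' z * (p - x)) * (h - 1)
   + (F' z - F' x) * (p - x)
   + F' x * (p - x + a n * (x + nu / 2 * x ^+ 2))
   + F x * (h - 1 - a n * (x * q x)).
  have -> : F p = F x + F' z * (p - x) by rewrite -FE; ring.
  have -> : F x * (h - 1 - a n * (x * q x)) =
    F x * (h - 1) - a n * (F' x * (x + nu / 2 * x ^+ 2)) by rewrite key; ring.
  by ring.
have T1 : `|F' z * (p - x) * (h - 1)| <= M * B * (Q + 1) * a n * A.
  rewrite normrM [X in X * _]normrM.
  have -> : M * B * (Q + 1) * a n * A = (M * (B * a n)) * ((Q + 1) * A) by ring.
  apply: ler_pM => //.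
  apply: ler_pM => //; first exact: le_trans DM.
  by rewrite (le_trans px)// ler_wpM2l// ltW.
have T2 : `|(F' z - F' x) * (p - x)| <= M * (B * B) * a n * A.
  rewrite normrM.
  have -> : M * (B * B) * a n * A = (M * (B * a n)) * (B * A) by ring.
  rewrite ler_pM// (le_trans F'zx)// ler_pM//.
  by rewrite (le_trans zx)// (le_trans px)// ler_wpM2l// ltW.
have T3 : `|F' x * (p - x + a n * (x + nu / 2 * x ^+ 2))| <= M * (e1 * A).
  by rewrite normrM ler_pM// (le_trans F'x).
have T4 : `|F x * (h - 1 - a n * (x * q x))| <= M * (e1 * A).
  by rewrite normrM ler_pM// (le_trans Fx).
have WA : W * a n * A <= e / 2 * A by rewrite ler_wpM2r.
have MA : 2 * M * e1 * A <= e / 2 * A by rewrite ler_wpM2r.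
rewrite (le_trans (ler_normD _ _))// (le_trans (lerD (ler_normD _ _) T4))//.
rewrite (le_trans (lerD (lerD (ler_normD _ _) T3) (lexx _)))//.
rewrite (le_trans (lerD (lerD (lerD T1 T2) (lexx _)) (lexx _)))//.
rewrite /W in WA; lra.
Unshelve. all: by end_near. Qed.

Variable G : nat -> R -> R.
Hypothesis GS : forall n (x : R), 0 <= x <= 1 -> G n.+1 x = G n (phi n x) * eta n x.
Hypothesis eta01 : forall n (x : R), 0 <= x <= 1 -> 0 <= eta n x <= 1.
Hypothesis G01 : forall n (x : R), 0 <= x <= 1 -> 0 <= G n x <= 1.
Hypothesis G_right : forall n (e : R), 0 < e -> exists2 d : R, 0 < d &
  forall x : R, 0 <= x <= 1 -> x <= d -> 1 - G n x <= e.

(* Started at n0, the bound e1 + (D * prod (1 - a j) + e1) * x is propagated. *)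
Lemma contraction :
  series a @ \oo --> +oo ->
  (forall e : R, 0 < e -> \forall n \near \oo, forall x : R, 0 <= x <= 1 ->
    `|F (phi n x) * eta n x - F x| <= e * (a n * x)) ->
  forall e : R, 0 < e -> \forall n \near \oo, forall x : R, 0 <= x <= 1 ->
    `|G n x - F x| <= e.
Proof.
move=> sa err e e0; pose e1 := e / 3; have e10 : 0 < e1 by rewrite divr_gt0.
have [n0 _ Hn0] := err _ e10.
have [C C0 FC] := bounded_lipschitz01_limit_pgf_compl K lambda nu_ge0.
have F0 : F 0 = 1 by rewrite /limit_pgf_compl log_limit_pgf0 expR0.
(* Only continuity of [G n0] at 0 is available: up to [d] it costs the constant [e1], and beyond [d]
   the trivial bound [1 + C] is at most [(1 + C) / d * x]. *)
have [D D0 start] : exists2 D : R, 0 <= D & forall x : R, 0 <= x <= 1 ->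
    `|G n0 x - F x| <= e1 + D * x.
  have [d d0 Gd] := G_right n0 e10.
  exists (C + (1 + C) / d) => [|x x01].
    by rewrite addr_ge0// divr_ge0 ?addr_ge0// ltW.
  have /andP[x0 x1] := x01; have /andP[G0 G1] := G01 n0 x01.
  have z01 : 0 <= (0 : R) <= 1 by rewrite lexx ler01.
  have [Fx FxL] := FC x 0 x01 z01.
  have [xd|dx] := leP x d.
    have := Gd x x01 xd => Gx; rewrite F0 subr0 (ger0_norm x0) in FxL.
    rewrite [X in `|X|](_ : _ = - (1 - G n0 x) - (F x - 1)); last by ring.
    rewrite (le_trans (ler_normB _ _))// normrN.
    rewrite ger0_norm ?subr_ge0// lerD// (le_trans FxL)// ler_wpM2r//.
    by rewrite lerDl divr_ge0 ?addr_ge0// ltW.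
  rewrite (le_trans (ler_normB _ _))// (ger0_norm G0).
  apply: (@le_trans _ _ (1 + C)); first exact: lerD.
  have : (1 + C) / d * d <= (1 + C) / d * x.
    by rewrite ler_wpM2l ?divr_ge0 ?addr_ge0// ltW.
  rewrite divfK ?gt_eqF// => le1.
  have : 0 <= C * x by rewrite mulr_ge0.
  rewrite mulrDl; lra.
pose pr m := \prod_(n0 <= j < n0 + m) (1 - a j).
have bound m (x : R) : 0 <= x <= 1 -> `|G (n0 + m)%N x - F x| <= e1 + (D * pr m + e1) * x.
  elim: m x => [|m IHm] x x01.
    rewrite /pr addn0 big_geq// mulr1 (le_trans (start x x01))// lerD2l.
    by case/andP: x01 => x0 x1; rewrite ler_wpM2r// lerDl ltW.
  have p01 := phi01 (n0 + m) x01; have /andP[h0 h1] := eta01 (n0 + m) x01.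
  have /andP[x0 x1] := x01.
  rewrite addnS GS//.
  set N := (n0 + m)%N; set p := phi N x; set h := eta N x.
  rewrite [X in `|X|](_ : _ = (G N p - F p) * h + (F p * h - F x)); last by ring.
  have en := Hn0 N (leq_addr _ _) x x01; rewrite -/p -/h in en.
  rewrite (le_trans (ler_normD _ _))//.
  have IH := IHm p p01; rewrite -/N in IH.
  (* The factor [h] is at most 1, and replacing [p] by [(1 - a N) * x] contracts the linear part
     only. *)
  have GF : `|(G N p - F p) * h| <= e1 + (D * pr m + e1) * ((1 - a N) * x).
    rewrite normrM; apply: (@le_trans _ _ (`|G N p - F p| * 1)).
      by rewrite ler_wpM2l// ger0_norm.
    rewrite mulr1; apply: (le_trans IH); rewrite lerD2l ler_wpM2l//.
      have pr0 : 0 <= pr m.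
        by rewrite /pr big_seq prodr_ge0// => j _; rewrite subr_ge0.
      by rewrite addr_ge0 ?mulr_ge0// ltW.
    exact: phi_le.
  rewrite (le_trans (lerD GF en))//.
  have -> : pr m.+1 = pr m * (1 - a N) by rewrite /pr addnS big_nat_recr// leq_addr.
  (* Equality holds: [e1 * (1 - a N) + e1 * a N = e1], so the coefficient [e1] of [x] is
     stationary. *)
  rewrite le_eqVlt; apply/orP; left; apply/eqP; ring.
have pr_cvg : \forall m \near \oo, D * pr m <= e1.
  pose S := \sum_(0 <= j < n0) a j.
  (* From 1 - a <= exp(-a), so divergence of the series sends the product to 0. *)
  have prle m : pr m <= expR (S - series a (n0 + m)%N).
    have -> : S - series a (n0 + m)%N = \sum_(n0 <= j < n0 + m) - a j.
      rewrite /series/= (@big_cat_nat _ _ _ n0)/= ?leq_addr//.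
      by rewrite sumrN opprD addNKr.
    rewrite /pr; elim: m => [|m IHm]; first by rewrite addn0 !big_geq// expR0.
    rewrite addnS !big_nat_recr ?leq_addr//= expRD ler_pM//.
    - by rewrite big_seq prodr_ge0// => j _; rewrite subr_ge0.
    - by rewrite subr_ge0.
    - exact: expR_ge1Dx.
  pose c := e1 / (D + 1).
  have c0 : 0 < c by rewrite divr_gt0// ltr_wpDl.
  have /cvgryPge/(_ (S - ln c)) [N _ HN] := sa.
  exists N => // m /= Nm.
  have sN : S - ln c <= series a (n0 + m)%N by apply: HN; rewrite /= (leq_trans Nm)// leq_addl.
  rewrite (@le_trans _ _ (D * c))//.
    rewrite ler_wpM2l// (le_trans (prle m))// -[leRHS]lnK ?posrE// ler_expR.
    by rewrite lerBlDr -lerBlDl.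
  rewrite /c mulrA ler_pdivrMr ?ltr_wpDl// mulrC ler_wpM2l ?(ltW e10)//.
  by rewrite lerDl.
have [m0 _ Hm0] := pr_cvg.
exists (n0 + m0)%N => // n /= n0n x x01; have /andP[x0 x1] := x01.
have le1 : (n0 <= n)%N by rewrite (leq_trans _ n0n)// leq_addr.
have := bound (n - n0)%N x x01; rewrite subnKC// => /le_trans; apply.
have /= := Hm0 (n - n0)%N; rewrite leq_subRL// => /(_ n0n) Dp.
have : (D * pr (n - n0)%N + e1) * x <= (e1 + e1) * x by rewrite ler_wpM2r// lerD2r.
have : (e1 + e1) * x <= e1 + e1 by rewrite ler_piMr// addr_ge0// ltW.
rewrite /e1; lra.
Qed.

End convergence.

(** * Power series expansion of the logarithm of the limit *)

Section power_series.
Variables (R : realType) (nu : R) (K : nat) (lambda : nat -> R).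
Hypothesis nu_ge0 : 0 <= nu.

(* [jump_rate i] and [jump_tail l] are the limits of P(eps_n = i) / a_n (i > 0)
   and P(eps_n > l) / a_n. *)
Definition jump_rate (i : nat) : R :=
  \sum_(1 <= k < K) (-1) ^+ (k + i) * 'C(k, i)%:R * lambda k.

Definition jump_tail (l : nat) : R :=
  \sum_(1 <= k < K) (-1) ^+ (k.-1 + l) * 'C(k.-1, l)%:R * lambda k.

(** Pascal's rule; the limit form of P(eps > l) = P(eps = l + 1) + P(eps > l + 1). *)
Lemma jump_tailS l : jump_tail l = jump_rate l.+1 + jump_tail l.+1.
Proof.
rewrite -big_split; apply: eq_big_nat => -[|k]//= _.
by rewrite addSn !addnS !exprS binS natrD; ring.
Qed.

Lemma jump_tail_eq0 l : (K <= l.+1)%N -> jump_tail l = 0.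
Proof.
move=> Kl; rewrite /jump_tail big_nat big1// => -[|k]// /andP[_ kK].
by rewrite bin_small ?mulr0 ?mul0r//= -ltnS (leq_trans kK).
Qed.

Lemma jump_tail_ge0 l :
  (forall i, (0 < i)%N -> 0 <= jump_rate i) -> 0 <= jump_tail l.
Proof.
move=> b0; have [m Km] : exists m, (K <= (m + l).+1)%N.
  by exists K; rewrite -addnS leq_addr.
elim: m l Km => [|m IHm] l Km; first by rewrite jump_tail_eq0.
by rewrite jump_tailS addr_ge0 ?b0// IHm// addnS -addSn.
Qed.

(** Expand x^k = (1 - (1 - x))^k. This is the limit of the identity (1 - E s^eps) / (1 - s) = sum of
    P(eps > l) s^l, at s = 1 - x. *)
Lemma immigration_slopeE x :
  immigration_slope K lambda x = - \sum_(0 <= l < K) jump_tail l * (1 - x) ^+ l.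
Proof.
under eq_bigr do rewrite mulr_suml.
rewrite exchange_big_nat/= -sumrN; apply: eq_big_nat => -[|k]// /andP[_ kK] /=.
have -> : x ^+ k = \sum_(0 <= l < K) (-1) ^+ l * 'C(k, l)%:R * (1 - x) ^+ l.
  rewrite (@big_cat_nat _ _ _ k.+1)//=; last exact: ltnW.
  rewrite [X in _ + X]big_nat [X in _ + X]big1 ?addr0; last first.
    by move=> i /andP[ki _]; rewrite bin_small// mulr0 mul0r.
  rewrite -[in LHS](subKr 1 x) exprBn big_mkord; apply: eq_bigr => i _.
  by rewrite expr1n mulr1 -mulr_natr; ring.
rewrite mulr_sumr -sumrN; apply: eq_bigr => l _.
by rewrite exprS exprD; ring.
Qed.

(** Chosen so that 1 + nu (1 - s) / 2 = (1 - c s) / d, where moreover d = 1 - c. *)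
Let c : R := (nu / 2) / (1 + nu / 2).
Let d : R := (1 + nu / 2)^-1.

(** Power series coefficients in s of (log G)'(s), that is of d * (sum of [jump_tail l] s^l) / (1 -
    c s); the recursion is the division by 1 - c s. Termwise integration gives [log_coef]. *)
Fixpoint dlog_coef (n : nat) : R :=
  if n is m.+1 then c * dlog_coef m + d * jump_tail n else d * jump_tail 0.

Definition log_coef (n : nat) : R :=
  if n is m.+1 then dlog_coef m / n%:R else 0.

Let u0 : 0 < 1 + nu / 2.
Proof. by rewrite ltr_pwDl// divr_ge0. Qed.

Let c0 : 0 <= c.
Proof. by rewrite divr_ge0 ?divr_ge0// ltW. Qed.

Let c1 : c < 1.
Proof. by rewrite ltr_pdivrMr// mul1r ltrDr. Qed.

Let d0 : 0 < d.
Proof. by rewrite invr_gt0. Qed.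

Let cd : d = 1 - c.
Proof. by rewrite /c /d; field; rewrite gt_eqF// ltr_pwDl. Qed.

Lemma dlog_coef_sum (s : R) m :
  (1 - c * s) * (\sum_(0 <= r < m.+1) dlog_coef r * s ^+ r) =
  d * \sum_(0 <= r < m.+1) jump_tail r * s ^+ r - c * dlog_coef m * s ^+ m.+1.
Proof.
elim: m => [|m IHm]; first by rewrite !big_nat1 /= expr0 expr1; ring.
by rewrite big_nat_recr// mulrDr IHm [in RHS]big_nat_recr//= !exprS; ring.
Qed.

(** From index [K] on the tails vanish and the recursion is geometric with ratio c < 1. *)
Lemma dlog_coef_cvg0 : dlog_coef @ \oo --> 0.
Proof.
have geo m : dlog_coef (m + K)%N = dlog_coef K * c ^+ m.
  elim: m => [|m IHm]; first by rewrite expr0 mulr1.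
  rewrite addSn /= IHm jump_tail_eq0 ?mulr0 ?addr0; last first.
    by rewrite -addSn -addSn leq_addl.
  by rewrite exprS; ring.
rewrite -(cvg_shiftn K) (_ : (fun n => _) = (fun m => dlog_coef K * c ^+ m)).
  have : (dlog_coef K * c ^+ m) @[m --> \oo] --> dlog_coef K * 0.
    by apply: cvgMl_tmp; apply: cvg_expr; rewrite ger0_norm.
  by rewrite mulr0.
by apply/funext => m; rewrite /= geo.
Qed.

Hypothesis jump_rate_ge0 : forall i, (0 < i)%N -> 0 <= jump_rate i.

Lemma dlog_coef_ge0 n : 0 <= dlog_coef n.
Proof.
elim: n => [|n IHn] /=; first by rewrite mulr_ge0// ?jump_tail_ge0// ltW.
by rewrite addr_ge0// mulr_ge0// ?jump_tail_ge0// ltW.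
Qed.

Lemma log_coef_ge0 n : 0 <= log_coef n.
Proof. by case: n => //= n; rewrite divr_ge0// dlog_coef_ge0. Qed.

(** By [dlog_coef_sum] the partial sum and the logarithm have derivatives differing by one boundary
    term, at most [dlog_coef M / d] on all of [0, 1]. Integrating from s = 0 by the mean value
    theorem therefore covers the endpoint s = 1 too. *)
Lemma log_limit_pgf_series (s : R) : 0 <= s <= 1 ->
  (fun M => \sum_(0 <= k < M) log_coef k * s ^+ k) @ \oo -->
  log_limit_pgf nu K lambda (1 - s) - log_limit_pgf nu K lambda 1.
Proof.
move=> /andP[s0 s1].
pose L := log_limit_pgf nu K lambda.
pose S M (x : R) := \sum_(0 <= k < M) log_coef k * (1 - x) ^+ k.
pose dS M (x : R) := - \sum_(0 <= r < M) dlog_coef r * (1 - x) ^+ r.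
have dSE M (x : R) : is_derive x 1 (S M.+1) (dS M x).
  have dterm k : is_derive x 1 (fun x : R => log_coef k * (1 - x) ^+ k)
      (log_coef k * (k%:R * (1 - x) ^+ k.-1) * - 1).
    apply: (@is_derive1_comp R (fun y => log_coef k * y ^+ k) (fun y => 1 - y)).
      exact: is_derive_scaled_exp.
    have := is_deriveB (is_derive_cst (1 : R) x (1 : R)) (is_derive_id x (1 : R)).
    by rewrite sub0r.
  apply: is_derive_eq.
    exact: (@is_derive_bigsum R _ (index_iota 0 M.+1)
      (fun k x => log_coef k * (1 - x) ^+ k) _ x (fun k _ => dterm k)).
  rewrite big_nat_recl// /= !mul0r add0r /dS -sumrN.
  by apply: eq_bigr => i _; field; rewrite nat1r pnatr_eq0.
have bnd M : (K <= M)%N ->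
    `|S M.+2 (1 - s) - (L (1 - s) - L 1)| <= dlog_coef M / d.
  move=> KM.
  have dD (x : R) : 0 <= x <= 1 ->
      is_derive x 1 (fun x => S M.+2 x - L x) (dS M.+1 x - dlog_limit_pgf nu K lambda x).
    move=> /andP[x0 _]; have dL := is_derive_log_limit_pgf K lambda nu_ge0 x0.
    exact: (is_deriveB (dSE M.+1 x) dL).
  have w01 : 0 <= (1 : R) <= 1 by rewrite lexx ler01.
  have v01 : 0 <= 1 - s <= 1 by rewrite subr_ge0 s1 gerBl.
  have [z [z01 _ e]] := mean_value01 dD w01 v01.
  have S1 : S M.+2 1 = 0.
    rewrite /S big_nat_recl// mul0r add0r big1// => i _.
    by rewrite subrr (expr0n _ _.+1) mulr0.
  move: e; rewrite S1 sub0r opprK => e.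
  have -> : S M.+2 (1 - s) - (L (1 - s) - L 1) = S M.+2 (1 - s) - L (1 - s) + L 1.
    by ring.
  rewrite e normrM; have /andP[z0 z1] := z01.
  have cz : 0 < 1 - c * (1 - z).
    rewrite subr_gt0 (le_lt_trans _ c1)// ler_piMr//.
    by rewrite gerBl.
  have dcz : d <= 1 - c * (1 - z).
    by rewrite cd lerB// ler_piMr// gerBl.
  have -> : dS M.+1 z - dlog_limit_pgf nu K lambda z =
      c * dlog_coef M * (1 - z) ^+ M.+1 / (1 - c * (1 - z)).
    rewrite /dlog_limit_pgf immigration_slopeE.
    have -> : 1 + nu / 2 * z = (1 - c * (1 - z)) / d.
      by rewrite /c /d; field; rewrite gt_eqF// ltr_pwDl.
    have -> : \sum_(0 <= l < K) jump_tail l * (1 - z) ^+ l =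
              \sum_(0 <= l < M.+1) jump_tail l * (1 - z) ^+ l.
      rewrite [in RHS](@big_cat_nat _ _ _ K)//=; last exact: leqW.
      rewrite [X in _ = _ + X]big_nat [X in _ = _ + X]big1 ?addr0// => i /andP[Ki _].
      by rewrite jump_tail_eq0 ?mul0r// leqW.
    rewrite /dS (canRL (mulKf (lt0r_neq0 cz)) (dlog_coef_sum (1 - z) M)).
    by field; rewrite !gt_eqF.
  have w0 : 0 <= 1 - z by rewrite subr_ge0.
  have t0 := dlog_coef_ge0 M.
  apply: (le_trans (ler_piMr _ _)) => //.
    by rewrite [1 - s - 1](_ : _ = - s) ?normrN ?ger0_norm//; ring.
  rewrite ger0_norm; last first.
    apply: divr_ge0; last exact: ltW.
    by apply: mulr_ge0; [exact: mulr_ge0|exact: exprn_ge0].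
  apply: ler_pM.
  - by apply: mulr_ge0; [exact: mulr_ge0|exact: exprn_ge0].
  - by rewrite invr_ge0 ltW.
  - by rewrite mulrAC ler_piMl// mulr_ile1 ?exprn_ge0 ?(ltW c1)// exprn_ile1// gerBl.
  - by rewrite lef_pV2.
apply/cvgrPdist_le => e e0.
have cvg0 : (dlog_coef M / d) @[M --> \oo] --> (0 : R).
  have : (dlog_coef M / d) @[M --> \oo] --> 0 / d.
    by apply: cvgMr_tmp; exact: dlog_coef_cvg0.
  by rewrite mul0r.
have [N _ HN] := cvgr0_norm_le _ cvg0 _ e0.
exists (maxn K N).+2 => // -[|[|M]]//=; rewrite !ltnS geq_max => /andP[KM NM].
have := bnd M KM; rewrite /S subKr distrC => /le_trans; apply.
by rewrite (le_trans (ler_norm _))// HN.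
Qed.

End power_series.

(** * Independent natural-valued random variables *)

Section nat_valued.
Context d (T : measurableType d) (R : realType) (P : probability T R).
Implicit Types (X Y : T -> nat) (B : set T).

Lemma measurable_nat_comp d' (T' : measurableType d') X (u : nat -> T') :
  measurable_fun setT X -> measurable_fun setT (u \o X).
Proof. by move=> mX; apply: measurableT_comp. Qed.

Lemma measurable_real_comp X (u : nat -> R) :
  measurable_fun setT X -> measurable_fun setT (fun w => u (X w)).
Proof. by move=> mX; apply: measurableT_comp. Qed.

Lemma measurable_nat_preimage X (A : set nat) :
  measurable_fun setT X -> measurable (X @^-1` A).
Proof. by move=> mX; rewrite -[X in measurable X]setTI; exact: mX. Qed.

Lemma measurable_nat_glue d' (T' : measurableType d') X (Z : nat -> T -> T') :
  measurable_fun setT X -> (forall k, measurable_fun setT (Z k)) ->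
  measurable_fun setT (fun w => Z (X w) w).
Proof.
move=> mX mZ _ A mA; rewrite setTI.
rewrite (_ : _ @^-1` A = \bigcup_k (X @^-1` [set k] `&` Z k @^-1` A)).
  apply: bigcupT_measurable => k; apply: measurableI.
    exact: measurable_nat_preimage.
  by rewrite -[X in measurable X]setTI; exact: mZ.
apply/seteqP; split => [w Aw|w [k _ [/= -> ]]//].
by exists (X w).
Qed.

(** The discrete substitute for conditioning on [X], on which the independence arguments below
    rest. *)
Lemma integral_nat_split X B (phi : T -> R) (u : nat -> R) :
  measurable_fun setT X -> measurable B ->
  measurable_fun setT phi -> (forall w, 0 <= phi w) -> (forall k, 0 <= u k) ->
  (\int[P]_(w in B) (phi w * u (X w))%:E =
   \sum_(0 <= k <oo) ((u k)%:E * \int[P]_(w in B `&` X @^-1` [set k]) (phi w)%:E))%E.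
Proof.
move=> mX mB mphi phi0 u0.
pose F k := B `&` X @^-1` [set k].
have mF k : measurable (F k) by apply: measurableI => //; exact: measurable_nat_preimage.
have BF : B = \bigcup_k F k.
  by apply/seteqP; split => [w Bw|w [k _ []]//]; exists (X w).
rewrite [in LHS]BF ge0_integral_bigcup//.
- apply: eq_eseriesr => k _.
  rewrite -ge0_integralZl//.
  + by apply: eq_integral => w /[!inE] -[_ /= ->]; rewrite -EFinM mulrC.
  + exact: mF.
  + by apply/measurable_EFinP; exact: measurable_funTS.
  + by move=> w _; rewrite lee_fin.
  + by rewrite lee_fin.
- apply/measurable_EFinP; apply: measurable_funTS.
  by apply: measurable_funM => //; exact: (measurable_nat_comp u mX).
- by move=> w _; rewrite lee_fin mulr_ge0.
- apply/trivIsetP => i j _ _ ij; apply/seteqP; split => // w [[_ /= ei] [_ /= ej]].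
  by move: ij; rewrite -ei ej eqxx.
Qed.

Lemma expectation_nat_split X (phi : T -> R) (u : nat -> R) :
  measurable_fun setT X ->
  measurable_fun setT phi -> (forall w, 0 <= phi w) -> (forall k, 0 <= u k) ->
  ('E_P[fun w => (phi w * u (X w))%R] =
   \sum_(0 <= k <oo) ((u k)%:E * \int[P]_(w in X @^-1` [set k]) (phi w)%:E))%E.
Proof.
move=> mX mphi phi0 u0; rewrite unlock integral_nat_split//.
by apply: eq_eseriesr => k _; rewrite setTI.
Qed.

Lemma expectation_nat X (u : nat -> R) :
  measurable_fun setT X -> (forall k, 0 <= u k) ->
  ('E_P[fun w => u (X w)] = \sum_(0 <= k <oo) ((u k)%:E * P (X @^-1` [set k])))%E.
Proof.
move=> mX u0; have := @expectation_nat_split X (cst 1) u mX.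
under eq_fun do rewrite mul1r; move=> -> //.
apply: eq_eseriesr => k _; congr (_ * _)%E.
have mXk := measurable_nat_preimage [set k] mX.
by have := integral_cst P mXk 1%E; rewrite mul1e.
Qed.

End nat_valued.

Lemma expectation_unit d (T : measurableType d) (R : realType)
    (P : probability T R) (X : T -> R) :
  measurable_fun setT X -> (forall w, 0 <= X w <= 1) ->
  exists2 r : R, 0 <= r <= 1 & ('E_P[X] = r%:E)%E.
Proof.
move=> mX X01.
have E0 : (0 <= 'E_P[X])%E by apply: expectation_ge0 => w; case/andP: (X01 w).
have E1 : ('E_P[X] <= 1)%E.
  rewrite -(expectation_cst P 1); apply: expectation_le => //.
  - by move=> w; case/andP: (X01 w).
  - by apply: aeW => w; case/andP: (X01 w).
have Ef : 'E_P[X]%E \is a fin_num by rewrite ge0_fin_numE// (le_lt_trans E1) ?ltry.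
exists (fine ('E_P[X])%E); last by rewrite fineK.
by rewrite -!lee_fin fineK// E0.
Qed.

Lemma same_law_expectation d1 (T1 : measurableType d1) d2 (T2 : measurableType d2)
    (R : realType) (P1 : probability T1 R) (P2 : probability T2 R)
    (X1 : T1 -> nat) (X2 : T2 -> nat) (u : nat -> R) :
  measurable_fun setT X1 -> measurable_fun setT X2 -> (forall k, 0 <= u k) ->
  same_law P1 P2 X1 X2 ->
  ('E_P1[fun w => u (X1 w)] = 'E_P2[fun w => u (X2 w)])%E.
Proof.
move=> m1 m2 u0 X12; rewrite !expectation_nat//.
by apply: eq_eseriesr => k _; rewrite X12.
Qed.

Section independent_products.
Context d (T : measurableType d) (R : realType) (P : probability T R).
Variables (I : choiceType) (X : I -> {RV P >-> nat}).
Hypothesis indep : mutually_independent X.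
Variable v : I -> nat -> R.
Hypothesis v0 : forall i k, 0 <= v i k.
Hypothesis v1 : forall i k, v i k <= 1.

Lemma measurable_prod_nat (J : seq I) :
  measurable_fun setT (fun w => \prod_(i <- J) v i (X i w)).
Proof.
elim: J => [|i J IHJ].
  under eq_fun do rewrite big_nil; exact: measurable_cst.
under eq_fun do rewrite big_cons; apply: measurable_funM => //.
exact: (measurable_nat_comp (v i)).
Qed.

Lemma measurable_cylinder (J : seq I) (A : I -> set nat) :
  measurable (\bigcap_(i in [set` J]) X i @^-1` A i).
Proof.
rewrite bigcap_seq; elim: J => [|i J IHJ]; first by rewrite big_nil.
by rewrite big_cons; apply: measurableI => //; exact: measurable_nat_preimage.
Qed.

(** The definition of independence speaks of events only. Mixing functions over [J1] with events
    over [J2] lets an induction trade them: splitting on the value of [X i] turns one function into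
    the event [X i = k], which joins [J2]. *)
Let mixed_independence (J1 J2 : seq I) (A : I -> set nat) : uniq (J1 ++ J2) ->
  (\int[P]_(w in \bigcap_(i in [set` J2]) X i @^-1` A i)
     (\prod_(i <- J1) v i (X i w))%:E =
   (\prod_(i <- J1) 'E_P[fun w => v i (X i w)]) *
   \prod_(i <- J2) P (X i @^-1` A i))%E.
Proof.
elim: J1 J2 A => [|i J1 IHJ] J2 A /=.
  move=> uJ2; under eq_integral do rewrite big_nil.
  have := integral_cst P (measurable_cylinder J2 A) 1%E.
  by rewrite big_nil !mul1e => ->; exact: indep.
rewrite mem_cat negb_or => /andP[/andP[iJ1 iJ2] uJ].
under eq_integral do rewrite big_cons mulrC.
have prod0 w : 0 <= \prod_(j <- J1) v j (X j w) by rewrite prodr_ge0.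
rewrite integral_nat_split//; last 2 first.
- exact: measurable_cylinder.
- exact: measurable_prod_nat.
pose A' k j := if j == i then [set k] else A j.
have IH k : (\int[P]_(w in \bigcap_(j in [set` J2]) X j @^-1` A j `&` X i @^-1` [set k])
    (\prod_(j <- J1) v j (X j w))%:E =
    (\prod_(j <- J1) 'E_P[fun w => v j (X j w)]) *
    (P (X i @^-1` [set k]) * \prod_(j <- J2) P (X j @^-1` A j)))%E.
  have := IHJ (i :: J2) (A' k).
  rewrite (perm_uniq (permEl (perm_catCA J1 [:: i] J2)))/= mem_cat negb_or iJ1 iJ2 uJ.
  move=> /(_ isT); rewrite big_cons {2}/A' eqxx.
  have -> : (\prod_(j <- J2) P (X j @^-1` A' k j) = \prod_(j <- J2) P (X j @^-1` A j))%E.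
    apply: eq_big_seq => j jJ2; rewrite /A'; case: eqP => // ji.
    by move: iJ2; rewrite -ji jJ2.
  move=> <-; congr (integral _ _ _).
  rewrite !bigcap_seq big_cons {1}/A' eqxx setIC; congr (_ `&` _).
  apply: eq_big_seq => j jJ2; rewrite /A'; case: eqP => // ji.
  by move: iJ2; rewrite -ji jJ2.
have Ev j : exists2 r : R, 0 <= r <= 1 & ('E_P[fun w => v j (X j w)] = r%:E)%E.
  apply: expectation_unit; first exact: (measurable_nat_comp (v j)).
  by move=> w; rewrite v0 v1.
have [r Cr] : exists r : R, (\prod_(j <- J1) 'E_P[fun w => v j (X j w)] = r%:E)%E.
  elim: J1 {iJ1 uJ prod0 IHJ IH} => [|j J IHJ]; first by exists 1; rewrite big_nil.
  have [r rE] := IHJ; have [s _ sE] := Ev j.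
  by exists (s * r); rewrite big_cons rE sE EFinM.
have [s Ds] : exists s : R, (\prod_(j <- J2) P (X j @^-1` A j) = s%:E)%E.
  elim: J2 {iJ2 uJ IH} => [|j J IHJ']; first by exists 1; rewrite big_nil.
  have [r' rE] := IHJ'.
  have Pj : P (X j @^-1` A j) \is a fin_num.
    by apply: fin_num_measure; exact: measurable_nat_preimage.
  by exists (fine (P (X j @^-1` A j)) * r'); rewrite big_cons rE EFinM fineK.
under eq_eseriesr => k _.
  rewrite IH Cr Ds muleCA (muleA (v i k)%:E) (muleC _ s%:E) muleA -EFinM.
  over.
rewrite nneseriesZl; last by move=> k _; rewrite mule_ge0 ?lee_fin.
rewrite big_cons Cr Ds (expectation_nat P _ (v0 i))//.
by rewrite -muleA -EFinM muleC.
Qed.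

Lemma independent_expectation_prod (J : seq I) : uniq J ->
  ('E_P[fun w => (\prod_(i <- J) v i (X i w))%R] = \prod_(i <- J) 'E_P[fun w => v i (X i w)])%E.
Proof.
move=> uJ; have := @mixed_independence J [::] (fun=> setT); rewrite cats0 => /(_ uJ).
rewrite bigcap_seq !big_nil mule1 => <-.
by rewrite unlock.
Qed.

End independent_products.

(** * Continuity theorem for generating functions *)

Section pgf_coefficients.
Variable R : realType.
Implicit Types (p u : nat -> R).

Lemma eseries_EFin_cvg p (l : R) : (forall k, 0 <= p k) ->
  (\sum_(0 <= k <oo) (p k)%:E = l%:E)%E -> series p @ \oo --> l.
Proof.
move=> p0 pl.
have : (\sum_(0 <= k < n) (p k)%:E)%E @[n --> \oo] --> l%:E.
  by rewrite -pl; apply: is_cvg_nneseries => k _ _; rewrite lee_fin.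
under eq_fun do rewrite sumEFin.
by move/fine_cvgP => [_].
Qed.

Lemma cvg_eseries_EFin p (l : R) :
  series p @ \oo --> l -> (\sum_(0 <= k <oo) (p k)%:E = l%:E)%E.
Proof.
move=> pl; apply/cvg_lim => //.
by under eq_fun do rewrite sumEFin; apply: cvg_EFin => //; exact: nearW.
Qed.

(** Total mass below 1 is allowed because the lemmas are also applied to masses weighted by a
    [0, 1]-valued product, in the independence proof for the branching process. *)
Definition subprobability p : Prop :=
  (forall k, 0 <= p k) /\ forall M, \sum_(0 <= k < M) p k <= 1.

Lemma weighted_series_bounds p u (c l : R) m :
  subprobability p -> (forall k, 0 <= u k) ->
  (forall k, (m <= k)%N -> u k <= c) ->
  series (fun k => p k * u k) @ \oo --> l ->
  \sum_(0 <= k < m) p k * u k <= l <=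
  \sum_(0 <= k < m) p k * u k + c * (1 - \sum_(0 <= k < m) p k).
Proof.
move=> [p0 p1] u0 uc ul.
have split M : (m <= M)%N -> series (fun k => p k * u k) M =
    \sum_(0 <= k < m) p k * u k + \sum_(m <= k < M) p k * u k.
  by move=> mM; rewrite /series/= (@big_cat_nat _ _ _ m).
apply/andP; split.
  apply: (cvgr_to_ge ul); exists m => // M /= mM; rewrite split// lerDl.
  by rewrite sumr_ge0// => k _; rewrite mulr_ge0.
apply: (cvgr_to_le ul); exists m => // M /= mM; rewrite split// lerD2l.
have c0 : 0 <= c by apply: le_trans (u0 m) (uc m _).
apply: (@le_trans _ _ (\sum_(m <= k < M) p k * c)).
  apply: ler_sum_nat => k /andP[mk _]; rewrite ler_wpM2l// uc//.
rewrite -mulr_suml mulrC ler_wpM2l// lerBrDl -(@big_cat_nat _ _ _ m)//.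
Qed.

Lemma cvg_sum_nat (f : nat -> nat -> R) (l : nat -> R) k :
  (forall j, (j < k)%N -> f ^~ j @ \oo --> l j) ->
  (fun n => \sum_(0 <= j < k) f n j) @ \oo --> \sum_(0 <= j < k) l j.
Proof.
elim: k => [|k IHk] fl.
  rewrite big_geq//; under eq_fun do rewrite big_geq//.
  exact: cvg_cst.
rewrite big_nat_recr//=; under eq_fun do rewrite big_nat_recr//=.
by apply: cvgD; [apply: IHk => j jk; apply: fl; exact: ltnW|exact: fl].
Qed.

(** Strong induction on [k]: once the lower coefficients are subtracted, dividing by s^k gives the
    k-th one up to an error of at most s, so a single small s suffices. *)
Lemma pgf_coef_cvg (p : nat -> nat -> R) (p' : nat -> R)
    (G : nat -> R -> R) (G' : R -> R) :
  (forall n, subprobability (p n)) -> subprobability p' ->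
  (forall n (s : R), 0 <= s <= 1 -> series (fun k => p n k * s ^+ k) @ \oo --> G n s) ->
  (forall s : R, 0 <= s <= 1 -> series (fun k => p' k * s ^+ k) @ \oo --> G' s) ->
  (forall s : R, 0 <= s <= 1 -> G ^~ s @ \oo --> G' s) ->
  forall k, p ^~ k @ \oo --> p' k.
Proof.
move=> pp pp' pG p'G' GG' k; elim/ltn_ind: k => k IHk.
apply/cvgrPdist_le => e e0.
(* The sandwich has width s <= e / 2 and its ends converge; the other half of [e] pays for that
   convergence. The bound 1 / 2 keeps s below 1. *)
pose s := Num.min (1 / 2) (e / 2).
have s0 : 0 < s by rewrite lt_min !divr_gt0.
have s01 : 0 <= s <= 1.
  by rewrite ltW//= ge_min ler_pdivrMr// mul1r ler1n.
have se : s <= e / 2 by rewrite ge_min lexx orbT.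
pose A (q : nat -> R) g := (g - \sum_(0 <= j < k) q j * s ^+ j) / s ^+ k.
have sk0 : 0 < s ^+ k by rewrite exprn_gt0.
have sandwich q g : subprobability q ->
    series (fun k => q k * s ^+ k) @ \oo --> g -> A q g - s <= q k <= A q g.
  move=> [q0 q1] qg.
  have u0 i : 0 <= s ^+ i by rewrite exprn_ge0// ltW.
  have uc i : (k.+1 <= i)%N -> s ^+ i <= s ^+ k.+1.
    by move=> ki; case/andP: s01 => ? ?; exact: ler_wiXn2l.
  have /andP[] := weighted_series_bounds (conj q0 q1) u0 uc qg.
  rewrite big_nat_recr//= => l1 l2.
  rewrite lerBlDr ler_pdivrMr// mulrDl -exprS ler_pdivlMr// lerBrDl l1 andbT.
  rewrite lerBlDl addrA (le_trans l2)// lerD2l ler_piMr ?exprn_ge0 ?(ltW s0)//.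
  by rewrite gerBl sumr_ge0.
have cvgA : (fun n => A (p n) (G n s)) @ \oo --> A p' (G' s).
  apply: cvgMr_tmp; apply: cvgB; first exact: GG'.
  by apply: cvg_sum_nat => j jk; apply: cvgMr_tmp; exact: IHk.
have e20 : 0 < e / 2 by rewrite divr_gt0.
move/cvgrPdist_le: cvgA => /(_ _ e20); apply: filterS => n An.
have /andP[a1 a2] := sandwich _ _ (pp n) (pG n s s01).
have /andP[b1 b2] := sandwich _ _ pp' (p'G' s s01).
by move: An; rewrite !ler_norml => /andP[An1 An2]; apply/andP; split; lra.
Qed.

(** Mass cannot escape because [p'] has total mass 1: a cutoff [m] catching all but [e / 4] of [p']
    eventually catches all but [e / 2] of [p n]. *)
Lemma weighted_mean_cvg (p : nat -> nat -> R) (p' u : nat -> R) (U : nat -> R) (U' : R) :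
  (forall n, subprobability (p n)) -> subprobability p' ->
  series p' @ \oo --> (1 : R) ->
  (forall k, 0 <= u k <= 1) ->
  (forall n, series (fun k => p n k * u k) @ \oo --> U n) ->
  series (fun k => p' k * u k) @ \oo --> U' ->
  (forall k, p ^~ k @ \oo --> p' k) -> U @ \oo --> U'.
Proof.
move=> pp pp' p'1 u01 pU p'U' pcvg.
have bounds q l m : subprobability q -> series (fun k => q k * u k) @ \oo --> l ->
  \sum_(0 <= k < m) q k * u k <= l <=
  \sum_(0 <= k < m) q k * u k + (1 - \sum_(0 <= k < m) q k).
  move=> qq ql; rewrite -[X in _ + X]mul1r; apply: weighted_series_bounds => // k.
  - by case/andP: (u01 k).
  - by move=> _; case/andP: (u01 k).
apply/cvgrPdist_le => e e0.
have e40 : 0 < e / 4 by rewrite divr_gt0.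
have /cvgrPdist_le/(_ _ e40)[m _ Hm] := p'1.
have := Hm m (leqnn m); rewrite /series/= => {}Hm.
have c1 : (fun n => \sum_(0 <= k < m) p n k * u k) @ \oo --> \sum_(0 <= k < m) p' k * u k.
  by apply: cvg_sum_nat => j jk; apply: cvgMr_tmp.
have c2 : (fun n => \sum_(0 <= k < m) p n k) @ \oo --> \sum_(0 <= k < m) p' k.
  exact: cvg_sum_nat.
near=> n.
have d1 : `|\sum_(0 <= k < m) p' k * u k - \sum_(0 <= k < m) p n k * u k| <= e / 4.
  by near: n; have /cvgrPdist_le/(_ _ e40) := c1.
have d2 : `|\sum_(0 <= k < m) p' k - \sum_(0 <= k < m) p n k| <= e / 4.
  by near: n; have /cvgrPdist_le/(_ _ e40) := c2.
have /andP[a1 a2] := bounds _ _ m (pp n) (pU n).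
have /andP[b1 b2] := bounds _ _ m pp' p'U'.
move: Hm d1 d2; rewrite !ler_norml => /andP[? ?] /andP[? ?] /andP[? ?].
by apply/andP; split; lra.
Unshelve. all: by end_near. Qed.

End pgf_coefficients.

(** * The branching recursion *)

Section nat_valued_measurability.
Context d (T : measurableType d).

Lemma measurable_addn (X Y : T -> nat) : measurable_fun setT X ->
  measurable_fun setT Y -> measurable_fun setT (fun w => (X w + Y w)%N).
Proof.
move=> mX mY; apply: (@measurable_nat_glue _ _ _ _ X (fun k w => (k + Y w)%N)) => // k.
exact: (measurable_nat_comp (addn k)).
Qed.

Lemma measurable_sumn (X : nat -> T -> nat) k :
  (forall j, measurable_fun setT (X j)) ->
  measurable_fun setT (fun w => \sum_(j < k) X j w)%N.
Proof.
move=> mX; elim: k => [|k IHk].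
  under eq_fun do rewrite big_ord0; exact: measurable_cst.
by under eq_fun do rewrite big_ord_recr; exact: measurable_addn.
Qed.

Lemma measurable_random_sum (N : T -> nat) (X : nat -> T -> nat) :
  measurable_fun setT N -> (forall j, measurable_fun setT (X j)) ->
  measurable_fun setT (fun w => \sum_(j < N w) X j w)%N.
Proof.
move=> mN mX.
apply: (@measurable_nat_glue _ _ _ _ N (fun k w => (\sum_(j < k) X j w)%N)) => // k.
exact: measurable_sumn.
Qed.

End nat_valued_measurability.

Lemma eseries_subprobability (R : realType) (p : nat -> R) :
  (forall k, 0 <= p k) -> (\sum_(0 <= k <oo) (p k)%:E <= 1)%E -> subprobability p.
Proof.
move=> p0 p1; split => // M; rewrite -lee_fin -sumEFin (le_trans _ p1)//.
by apply: nneseries_lim_ge => k _ _; rewrite lee_fin.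
Qed.

Section nat_pmf.
Context d (T : measurableType d) (R : realType) (P : probability T R).
Variable Z : T -> nat.
Hypothesis mZ : measurable_fun setT Z.

Definition nat_pmf (k : nat) : R := fine (P (Z @^-1` [set k])).

Lemma nat_pmfE k : P (Z @^-1` [set k]) = (nat_pmf k)%:E.
Proof.
by rewrite fineK//; apply: fin_num_measure; exact: measurable_nat_preimage.
Qed.

Lemma nat_pmf_ge0 k : 0 <= nat_pmf k.
Proof. by rewrite -lee_fin -nat_pmfE. Qed.

Lemma nat_pmf_series (u : nat -> R) (l : R) : (forall k, 0 <= u k) ->
  ('E_P[fun w => u (Z w)] = l%:E)%E ->
  series (fun k => nat_pmf k * u k) @ \oo --> l.
Proof.
move=> u0; rewrite expectation_nat// => El.
apply: eseries_EFin_cvg; first by move=> k; rewrite mulr_ge0// nat_pmf_ge0.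
by rewrite -El; apply: eq_eseriesr => k _; rewrite nat_pmfE EFinM muleC.
Qed.

Lemma nat_pmf_series1 : series nat_pmf @ \oo --> (1 : R).
Proof.
have := @nat_pmf_series (fun=> 1) 1 (fun=> ler01).
by rewrite expectation_cst (_ : (fun k => _) = nat_pmf)//; [exact|apply/funext => k; rewrite mulr1].
Qed.

Lemma nat_pmf_subprobability : subprobability nat_pmf.
Proof.
apply: eseries_subprobability; first exact: nat_pmf_ge0.
by rewrite (cvg_eseries_EFin nat_pmf_series1).
Qed.

End nat_pmf.

Section gw_recursion.
Context (R : realType) d (T : measurableType d) (P : probability T R).
Variables (xi0 : nat -> {RV P >-> nat}) (xi : nat -> nat -> {RV P >-> nat}).
Variable eps : nat -> {RV P >-> nat}.
Hypothesis indep : mutually_independent (offspring_immigration xi eps).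
Hypothesis ident : forall n j, same_law P P (xi n j) (xi0 n).

Local Notation X := (offspring_immigration xi eps).
Local Notation Y := (gw_process xi eps).

Lemma measurable_gw_process n : measurable_fun setT (Y n).
Proof.
elim: n => [|n IHn] /=.
  exact: measurable_cst.
apply: measurable_addn => //.
exact: (measurable_random_sum IHn (fun j => measurable_funPT (xi n j))).
Qed.

Let generation (i : (nat * nat) + nat) : nat :=
  match i with inl nj => nj.1 | inr n => n end.

(** The variables that determine [Y n.+1] on the event [Y n = k]. *)
Let family n k : seq ((nat * nat) + nat) :=
  inr n :: [seq inl (n, j) | j <- iota 0 k].

Let family_gen n k i : i \in family n k -> generation i = n.
Proof.
by rewrite inE => /predU1P[->//|/mapP[j _ ->]].
Qed.

Let family_uniq n k : uniq (family n k).
Proof.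
rewrite /family/= map_inj_uniq ?iota_uniq ?andbT; last by move=> i j [].
by apply/mapP => -[].
Qed.

Definition rv_pgf (Z : T -> nat) (s : R) : R := fine ('E_P[fun w => (s ^+ Z w)%R])%E.

Lemma rv_pgfE (Z : T -> nat) (s : R) : measurable_fun setT Z -> 0 <= s <= 1 ->
  ('E_P[fun w => (s ^+ Z w)%R] = (rv_pgf Z s)%:E)%E /\ 0 <= rv_pgf Z s <= 1.
Proof.
move=> mZ /andP[s0 s1].
have [r r01 rE] : exists2 r : R, 0 <= r <= 1 & ('E_P[fun w => (s ^+ Z w)%R] = r%:E)%E.
  apply: expectation_unit; first exact: (measurable_real_comp (GRing.exp s) mZ).
  by move=> w; rewrite exprn_ge0// exprn_ile1.
by rewrite /rv_pgf rE.
Qed.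

Lemma prod_family (v : (nat * nat) + nat -> nat -> R) n k (s : R) w :
  (forall i, generation i = n -> v i = (fun m : nat => s ^+ m : R)) ->
  \prod_(i <- family n k) v i (X i w) = s ^+ (\sum_(j < k) xi n j w + eps n w).
Proof.
move=> vs; rewrite big_cons vs//= big_map exprD mulrC; congr (_ * _).
elim: k => [|k IHk]; first by rewrite big_nil big_ord0.
by rewrite -addn1 iotaD big_cat IHk/= big_seq1 vs// addn1 big_ord_recr exprD.
Qed.

Lemma prod_expectation_family (v : (nat * nat) + nat -> nat -> R) n k (s : R) :
  0 <= s <= 1 -> (forall i, generation i = n -> v i = (fun m : nat => s ^+ m : R)) ->
  (\prod_(i <- family n k) 'E_P[fun w => v i (X i w)] =
   (rv_pgf (eps n) s * rv_pgf (xi0 n) s ^+ k)%:E)%E.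
Proof.
move=> s01 vs; have /andP[s0 s1] := s01.
rewrite big_cons vs//= (rv_pgfE (measurable_funPT (eps n)) s01).1 EFinM; congr (_ * _)%E.
rewrite big_map; elim: k => [|k IHk]; first by rewrite big_nil.
rewrite -addn1 iotaD big_cat IHk/= big_seq1 vs//= addn1 exprSr EFinM; congr (_ * _)%E.
rewrite -(rv_pgfE (measurable_funPT (xi0 n)) s01).1.
by apply: same_law_expectation => // m; rewrite exprn_ge0.
Qed.

(** Independence of [Y n] from generations [n] and later, tested on products of [0, 1]-valued
    functions; the functions [v] are general so that powers of s and test functions of later
    generations can be mixed. *)
Let past_independent n := forall k J (v : (nat * nat) + nat -> nat -> R),
  uniq J -> (forall i, i \in J -> (n <= generation i)%N) ->
  (forall i m, 0 <= v i m) -> (forall i m, v i m <= 1) ->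
  (\int[P]_(w in Y n @^-1` [set k]) (\prod_(i <- J) v i (X i w))%:E =
   P (Y n @^-1` [set k]) * \prod_(i <- J) 'E_P[fun w => v i (X i w)])%E.

(** On [Y n = k] the power of s is a product over [family n k], to which [past_independent] applies
    together with [J]; summing over [k] composes the generating functions. The later variables in
    [J] are carried along for the induction on [n]. *)
Let step_expectation n J (v : (nat * nat) + nat -> nat -> R) (s : R) :
  past_independent n -> 0 <= s <= 1 ->
  uniq J -> (forall i, i \in J -> (n < generation i)%N) ->
  (forall i m, 0 <= v i m) -> (forall i m, v i m <= 1) ->
  ('E_P[fun w => (\prod_(i <- J) v i (X i w) * s ^+ Y n.+1 w)%R] =
   (rv_pgf (Y n) (rv_pgf (xi0 n) s) * rv_pgf (eps n) s)%:E *
     \prod_(i <- J) 'E_P[fun w => v i (X i w)])%E.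
Proof.
move=> past s01 uJ genJ v0 v1; have /andP[s0 s1] := s01.
pose phi w := \prod_(i <- J) v i (X i w) * s ^+ Y n.+1 w.
have mphi : measurable_fun setT phi.
  apply: measurable_funM; first exact: measurable_prod_nat.
  exact: (measurable_real_comp (GRing.exp s) (measurable_gw_process n.+1)).
have phi0 w : 0 <= phi w by rewrite mulr_ge0 ?exprn_ge0// prodr_ge0.
have := @expectation_nat_split _ _ _ P (Y n) phi (fun=> 1)
  (measurable_gw_process n) mphi phi0 (fun=> ler01).
under eq_fun do rewrite mulr1; rewrite /phi => ->.
(* Since [J] lies in strictly later generations, this override leaves [v] unchanged on [J]. *)
pose v' i := if generation i == n then (fun m : nat => s ^+ m : R) else v i.
have v's i : generation i = n -> v' i = (fun m : nat => s ^+ m : R) by rewrite /v' => ->; rewrite eqxx.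
have v'J i : i \in J -> v' i = v i.
  by move=> /genJ; rewrite /v'; case: eqP => // ->; rewrite ltnn.
have [r Er] : exists r : R, (\prod_(i <- J) 'E_P[fun w => v i (X i w)] = r%:E)%E.
  elim: (J) => [|i K [r rE]]; first by exists 1; rewrite big_nil.
  have [q _ qE] : exists2 q : R, 0 <= q <= 1 & ('E_P[fun w => v i (X i w)] = q%:E)%E.
    apply: expectation_unit; first exact: (measurable_real_comp (v i)).
    by move=> w; rewrite v0 v1.
  by exists (q * r); rewrite big_cons rE qE EFinM.
have term k : (1%:E * \int[P]_(w in Y n @^-1` [set k]) (phi w)%:E =
    (rv_pgf (eps n) s * r)%:E * ((rv_pgf (xi0 n) s ^+ k)%:E * P (Y n @^-1` [set k])))%E.
  rewrite mul1e.
  transitivity (\int[P]_(w in Y n @^-1` [set k])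
      (\prod_(i <- family n k ++ J) v' i (X i w))%:E)%E.
    apply: eq_integral => w /[!inE] Yk; rewrite big_cat (prod_family _ _ v's) /phi/= (Yk : Y n w = k) mulrC.
    congr (_ * _)%:E; apply: eq_big_seq => i iJ.
    by rewrite v'J.
  rewrite past.
  - rewrite big_cat/= (prod_expectation_family _ s01 v's).
    rewrite (_ : (\prod_(i <- J) _)%E = r%:E); last first.
      by rewrite -Er; apply: eq_big_seq => i iJ; rewrite v'J.
    by rewrite muleC -EFinM muleA -EFinM; congr (_%:E * _)%E; ring.
  - rewrite cat_uniq family_uniq uJ andbT/=; apply/hasPn => i iJ.
    by apply/negP => /family_gen iJn; move: (genJ i iJ); rewrite iJn ltnn.
  - by move=> i; rewrite mem_cat => /orP[/family_gen ->//|/genJ /ltnW].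
  - by move=> i m; rewrite /v'; case: ifP => // _; rewrite exprn_ge0.
  - by move=> i m; rewrite /v'; case: ifP => // _; rewrite exprn_ile1.
under eq_eseriesr do rewrite term.
have /andP[f0 f1] := (rv_pgfE (measurable_funPT (xi0 n)) s01).2.
rewrite nneseriesZl; last by move=> k _; rewrite mule_ge0 ?lee_fin ?exprn_ge0.
rewrite -(@expectation_nat _ _ _ P (Y n) (fun m : nat => rv_pgf (xi0 n) s ^+ m : R)).
- rewrite (rv_pgfE (measurable_gw_process n) _).1 ?f0//.
  by rewrite Er -!EFinM; congr (_%:E); ring.
- exact: measurable_gw_process.
- by move=> k; rewrite exprn_ge0.
Qed.

(* The factorization is known for the functions s ^ Y_(n+1) only; uniqueness of
   the coefficients of a power series transfers it to the events Y_(n+1) = k. *)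
Let gw_past_independent n : past_independent n.
Proof.
elim: n => [|n IHn] k J v uJ genJ v0 v1.
  have := independent_expectation_prod indep v0 v1 uJ.
  case: k => [|k].
    rewrite [_ @^-1` _](_ : _ = setT); last by apply/seteqP; split.
    rewrite probability_setT mul1e => <-; by rewrite expectation.unlock.
  rewrite [_ @^-1` _](_ : _ = set0); last by apply/seteqP; split.
  by rewrite integral_set0 measure0 mul0e.
pose PJ w := \prod_(i <- J) v i (X i w).
have mPJ : measurable_fun setT PJ by exact: measurable_prod_nat.
have PJ0 w : 0 <= PJ w by rewrite prodr_ge0.
have PJ1 w : PJ w <= 1.
  by rewrite /PJ; apply: prodr_ile1 => i _; rewrite v0 v1.
have mY := measurable_gw_process n.+1.
have mYk m : measurable (Y n.+1 @^-1` [set m]) by exact: measurable_nat_preimage.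
have [C C01 EC] : exists2 C : R, 0 <= C <= 1 & ('E_P[PJ] = C%:E)%E.
  by apply: expectation_unit => // w; rewrite PJ0 PJ1.
have prodC : (\prod_(i <- J) 'E_P[fun w => v i (X i w)] = C%:E)%E.
  by rewrite -EC independent_expectation_prod.
pose alpha m := fine (\int[P]_(w in Y n.+1 @^-1` [set m]) (PJ w)%:E)%E.
have alphaE m : (\int[P]_(w in Y n.+1 @^-1` [set m]) (PJ w)%:E = (alpha m)%:E)%E.
  rewrite fineK// ge0_fin_numE; last by apply: integral_ge0 => w _; rewrite lee_fin.
  apply: (@le_lt_trans _ _ (\int[P]_(w in Y n.+1 @^-1` [set m]) (cst 1%E w))%E).
    apply: ge0_le_integral => //.
    - by move=> w _; rewrite lee_fin.
    - by apply/measurable_EFinP; exact: measurable_funTS.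
    - by move=> w _; rewrite lee_fin.
  by rewrite integral_cst// mul1e (le_lt_trans (probability_le1 _ _))// ltry.
have alpha0 m : 0 <= alpha m.
  by rewrite -lee_fin -alphaE; apply: integral_ge0 => w _; rewrite lee_fin.
have alphas (s : R) : 0 <= s <= 1 ->
    (\sum_(0 <= m <oo) (alpha m * s ^+ m)%:E = 'E_P[fun w => (PJ w * s ^+ Y n.+1 w)%R])%E.
  move=> /andP[s0 s1]; rewrite (@expectation_nat_split _ _ _ P _ _ (GRing.exp s))//.
    by apply: eq_eseriesr => m _; rewrite alphaE -EFinM mulrC.
  by move=> k'; rewrite exprn_ge0.
pose beta m := C * nat_pmf P (Y n.+1) m.
have alphacvg (s : R) : 0 <= s <= 1 -> series (fun m => alpha m * s ^+ m) @ \oo -->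
    C * (rv_pgf (Y n) (rv_pgf (xi0 n) s) * rv_pgf (eps n) s).
  move=> s01; have /andP[s0 s1] := s01.
  apply: eseries_EFin_cvg; first by move=> m; rewrite mulr_ge0// exprn_ge0.
  by rewrite alphas// (step_expectation IHn s01 uJ genJ v0 v1) prodC -EFinM mulrC.
have betacvg (s : R) : 0 <= s <= 1 -> series (fun m => beta m * s ^+ m) @ \oo -->
    C * (rv_pgf (Y n) (rv_pgf (xi0 n) s) * rv_pgf (eps n) s).
  move=> s01; have /andP[s0 s1] := s01.
  rewrite (_ : series _ = (fun M => C * series (fun m => nat_pmf P (Y n.+1) m * s ^+ m) M)).
    apply: cvgMl_tmp; apply: nat_pmf_series => //; first by move=> m; rewrite exprn_ge0.
    have := @step_expectation n [::] v s IHn s01 isT.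
    rewrite big_nil mule1 => <-//.
    by under [in RHS]eq_fun do rewrite big_nil mul1r.
  apply/funext => M; rewrite /series/= mulr_sumr; apply: eq_bigr => m _.
  by rewrite mulrA.
have salpha : subprobability alpha.
  apply: eseries_subprobability => //.
  have := alphas 1; rewrite ler01 lexx => /(_ isT).
  under eq_eseriesr do rewrite expr1n mulr1.
  move=> ->; under eq_fun do rewrite expr1n mulr1.
  by rewrite EC lee_fin; case/andP: C01.
have sbeta : subprobability beta.
  have [p0 p1] := nat_pmf_subprobability P mY; have /andP[C0 C1] := C01.
  split => [m|M]; first by rewrite mulr_ge0.
  by rewrite -mulr_sumr mulr_ile1// sumr_ge0.
pose A s := C * (rv_pgf (Y n) (rv_pgf (xi0 n) s) * rv_pgf (eps n) s).
(* The convergence theorem for constant sequences is the uniqueness of coefficients. *)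
have h : (fun=> alpha k) @ \oo --> beta k.
  apply: (@pgf_coef_cvg R (fun=> alpha) beta (fun=> A) A) => // s _.
  exact: cvg_cst.
have ab : alpha k = beta k by rewrite -(cvg_lim (@Rhausdorff R) h) lim_cst.
by rewrite alphaE prodC nat_pmfE// -EFinM ab mulrC.
Qed.

Lemma gw_pgf_rec n (s : R) : 0 <= s <= 1 ->
  rv_pgf (Y n.+1) s = rv_pgf (Y n) (rv_pgf (xi0 n) s) * rv_pgf (eps n) s.
Proof.
move=> s01; have /andP[s0 s1] := s01.
have E : ('E_P[fun w => (1 * s ^+ Y n.+1 w)%R] =
    (rv_pgf (Y n) (rv_pgf (xi0 n) s) * rv_pgf (eps n) s)%:E)%E.
  have := @step_expectation n [::] (fun _ _ => 1) s (@gw_past_independent n) s01 isT.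
  rewrite [X in (_ * X)%E]big_nil mule1 => <-//.
  by under [in RHS]eq_fun do rewrite big_nil.
move: E; under eq_fun do rewrite mul1r.
by rewrite (rv_pgfE (measurable_gw_process n.+1) s01).1 => -[].
Qed.

End gw_recursion.

(** * Factorial moments *)

(** Since C(n, k) C(k, i) = C(n, i) C(n - i, k - i), the sum is C(n, i) times the Bonferroni sum for
    n - i at x = 1, where (1 - x)^(n - i) is the indicator of n = i. *)
Lemma indicator_bonferroni (R : realDomainType) (n i K : nat) : (i < K)%N ->
  `|(n == i)%:R - \sum_(0 <= k < K) (-1) ^+ (k + i) * 'C(k, i)%:R * 'C(n, k)%:R|
    <= 'C(K, i)%:R * 'C(n, K)%:R :> R.
Proof.
move=> iK.
have binD m l : ('C(i + l, i) * 'C(i + m, i + l) = 'C(i + m, i) * 'C(m, l))%N.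
  have [lm|ml] := leqP l m; last by rewrite [X in (_ * X)%N]bin_small ?ltn_add2l// (bin_small ml) !muln0.
  apply/eqP; rewrite -(@eqn_pmul2r (i`! * l`! * (m - l)`!)) ?muln_gt0 ?fact_gt0//.
  apply/eqP; transitivity (i + m)`!.
    rewrite -(@bin_fact (i + m) (i + l)) ?leq_add2l// subnDl.
    by rewrite -(@bin_fact (i + l) i) ?leq_addr// addKn; ring.
  rewrite -(@bin_fact (i + m) i) ?leq_addr// addKn.
  by rewrite -(bin_fact lm); ring.
rewrite (@big_cat_nat _ _ _ i)/=//; last exact: ltnW.
rewrite big_nat big1 ?add0r; last first.
  by move=> k /andP[_ ki]; rewrite (bin_small ki) mulr0 mul0r.
have [ni|] := ltnP n i.
  rewrite ltn_eqF// big_nat big1 ?subr0 ?normr0 ?mulr_ge0// => k /andP[ik _].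
  by rewrite [X in _ * X%:R]bin_small ?mulr0// (leq_trans ni).
move=> /subnKC; set m := (n - i)%N => <-; rewrite -{1}[i in _ == i]addn0 eqn_add2l.
have -> : \sum_(i <= k < K) (-1) ^+ (k + i) * 'C(k, i)%:R * 'C(i + m, k)%:R =
   'C(i + m, i)%:R * \sum_(0 <= l < K - i) (-1) ^+ l * 'C(m, l)%:R * 1 ^+ l :> R.
  rewrite -{1}[i]add0n -{2}(subnK (ltnW iK)) big_addn mulr_sumr addnK.
  apply: eq_bigr => l _; rewrite [(l + i)%N]addnC -mulrA -natrM binD natrM.
  by rewrite expr1n addnAC exprD addnn -signr_odd odd_double expr0; ring.
have z1 : 0 <= (1 : R) <= 1 by rewrite lexx ler01.
have := bonferroni_norm m (K - i) z1; rewrite subrr expr0n => B.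
have -> : (m == 0%N)%:R = 'C(i + m, i)%:R * (m == 0%N)%:R :> R.
  by case: eqP => [->|_]; rewrite ?addn0 ?binn ?mulr1 ?mulr0.
rewrite -mulrBr normrM ger0_norm//.
have -> : 'C(K, i)%:R * 'C(i + m, K)%:R = 'C(i + m, i)%:R * ('C(m, K - i)%:R * 1 ^+ (K - i)) :> R.
  by rewrite expr1n mulr1 -!natrM -binD subnKC// ltnW.
by rewrite ler_wpM2l.
Qed.

Section binomial_moments.
Context d (T : measurableType d) (R : realType) (P : probability T R).
Variable X : T -> nat.
Hypothesis mX : measurable_fun setT X.

Let EC k := ('E_P[fun w => ('C(X w, k)%:R)%R])%E.

(** The factorial moment divided by k!. An infinite moment is sent to 0 by [fine], hence the
    [fin_num] hypotheses below. *)
Definition binom_moment (k : nat) : R := fine (EC k).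

Lemma factorial_moment_ge0 k : (0 <= factorial_moment P X k)%E.
Proof. by apply: expectation_ge0 => w. Qed.

Lemma factorial_momentE k : (factorial_moment P X k = (k`!)%:R%:E * EC k)%E.
Proof.
rewrite /factorial_moment /EC expectation.unlock -ge0_integralZl//.
- by apply: eq_integral => w _; rewrite -EFinM -natrM mulnC bin_ffact.
- by apply/measurable_EFinP; exact: (measurable_real_comp (fun n => 'C(n, k)%:R) mX).
Qed.

Lemma factorial_moment_fin k : factorial_moment P X k \is a fin_num ->
  EC k = (binom_moment k)%:E.
Proof.
move=> Ffin; rewrite fineK//; move: Ffin; rewrite factorial_momentE.
have E0 : (0 <= EC k)%E by apply: expectation_ge0 => w.
rewrite !ge0_fin_numE ?mule_ge0 ?lee_fin//.
move: E0; case: (EC k) => // [r|]; first by move=> *; rewrite ltry.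
by rewrite gt0_muley ?lte_fin ?ltr0n ?fact_gt0.
Qed.

Lemma fine_factorial_moment k : factorial_moment P X k \is a fin_num ->
  fine (factorial_moment P X k) = (k`!)%:R * binom_moment k.
Proof. by move=> Ffin; rewrite factorial_momentE factorial_moment_fin. Qed.

Let integrable_binom k : EC k = (binom_moment k)%:E ->
  P.-integrable setT (EFin \o (fun w => 'C(X w, k)%:R)).
Proof.
move=> Ek; apply/integrableP; split.
  by apply/measurable_EFinP; exact: (measurable_real_comp (fun n => 'C(n, k)%:R) mX).
under eq_integral do rewrite /= ger0_norm//.
by move: Ek; rewrite /EC expectation.unlock => ->; rewrite ltry.
Qed.

Let Rint_binom k : Rintegral P setT (fun w => 'C(X w, k)%:R) = binom_moment k.
Proof. by rewrite /binom_moment /EC expectation.unlock. Qed.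

Lemma binom_moment_bound (K : nat) (u c : nat -> R) (D : R) :
  (forall k, (k <= K)%N -> factorial_moment P X k \is a fin_num) ->
  (forall n, 0 <= u n <= 1) ->
  (forall n, `|u n - \sum_(0 <= k < K) c k * 'C(n, k)%:R| <= D * 'C(n, K)%:R) ->
  `|fine ('E_P[fun w => u (X w)])%E - \sum_(0 <= k < K) c k * binom_moment k|
    <= D * binom_moment K.
Proof.
move=> Ffin u01 uD.
have iu : P.-integrable setT (EFin \o (fun w => u (X w))).
  apply/integrableP; split.
    by apply/measurable_EFinP; exact: (measurable_real_comp u mX).
  have [|r _] := @expectation_unit _ _ _ P _ (measurable_real_comp u mX).
    by move=> w; exact: u01.
  rewrite expectation.unlock => Er.
  under eq_integral do rewrite /= ger0_norm ?(andP (u01 _)).1//.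
  by rewrite Er ltry.
have iS M : (M <= K)%N ->
   P.-integrable setT (EFin \o (fun w => \sum_(0 <= k < M) c k * 'C(X w, k)%:R)) /\
   Rintegral P setT (fun w => \sum_(0 <= k < M) c k * 'C(X w, k)%:R) =
   \sum_(0 <= k < M) c k * binom_moment k.
  elim: M => [|M IHM] MK.
    under eq_fun do rewrite big_geq//.
    rewrite big_geq// Rintegral_cst// mul0r; split => //.
    exact: integrable0.
  have [i1 i2] := IHM (ltnW MK).
  have iM := integrable_binom (factorial_moment_fin (Ffin M (ltnW MK))).
  have icM : P.-integrable setT (EFin \o (fun w => c M * 'C(X w, M)%:R)).
    exact: (integrableZl _ (c M) iM).
  under eq_fun do rewrite big_nat_recr//=.
  split; first exact: (integrableD _ i1 icM).
  by rewrite RintegralD// i2 RintegralZl// Rint_binom big_nat_recr.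
have [iK SK] := iS K (leqnn K).
have iB := integrable_binom (factorial_moment_fin (Ffin K (leqnn K))).
have -> : fine ('E_P[fun w => u (X w)])%E = Rintegral P setT (fun w => u (X w)).
  by rewrite expectation.unlock.
rewrite -SK -RintegralB// -Rint_binom -RintegralZl//.
have idiff : P.-integrable setT
    (EFin \o (fun w => u (X w) - \sum_(0 <= k < K) c k * 'C(X w, k)%:R)).
  exact: (integrableB _ iu iK).
rewrite (le_trans (le_normr_Rintegral _ idiff))//.
apply: le_Rintegral => //.
- exact: (integrable_norm idiff).
- exact: (integrableZl _ D iB).
Qed.

Lemma rv_pgf_bonferroni (K : nat) (x : R) :
  (forall k, (k <= K)%N -> factorial_moment P X k \is a fin_num) ->
  0 <= x <= 1 ->
  `|rv_pgf P X (1 - x) - \sum_(0 <= k < K) (-1) ^+ k * binom_moment k * x ^+ k|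
    <= binom_moment K * x ^+ K.
Proof.
move=> Ffin x01; have /andP[x0 x1] := x01.
under eq_bigr do rewrite mulrAC; rewrite mulrC.
apply: (@binom_moment_bound K (fun n => (1 - x) ^+ n) (fun k => (-1) ^+ k * x ^+ k)) => // n.
  by rewrite exprn_ge0 ?exprn_ile1 ?subr_ge0// gerBl.
under eq_bigr do rewrite mulrAC; rewrite mulrC.
exact: bonferroni_norm.
Qed.

(** As P(X = i) >= 0, its truncated inclusion-exclusion sum is negative by at most the remainder. *)
Lemma binom_moment_indicator (K i : nat) :
  (forall k, (k <= K)%N -> factorial_moment P X k \is a fin_num) -> (i < K)%N ->
  - ('C(K, i)%:R * binom_moment K) <=
    \sum_(0 <= k < K) (-1) ^+ (k + i) * 'C(k, i)%:R * binom_moment k.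
Proof.
move=> Ffin iK.
have := @binom_moment_bound K (fun n => (n == i)%:R)
  (fun k => (-1) ^+ (k + i) * 'C(k, i)%:R) 'C(K, i)%:R Ffin.
move=> /(_ _ (fun n => indicator_bonferroni R n iK)).
have E0 : 0 <= fine ('E_P[fun w => ((X w == i)%:R)%R])%E.
  by apply: fine_ge0; apply: expectation_ge0 => w.
rewrite ler_norml => /(_ _)/andP[|_ h]; last by lra.
by move=> n; case: (n == i); rewrite ?lexx ?ler01.
Qed.

Lemma binom_moment0 : binom_moment 0 = 1.
Proof.
rewrite /binom_moment /EC; under eq_fun do rewrite bin0.
by rewrite expectation_cst.
Qed.

End binomial_moments.

(** * Digit expansions of a uniform point *)

Section affine_measure.
Variable R : realType.
Local Notation mu := (@lebesgue_measure R).

(** The pushforward, rescaled by 1 / p, agrees with Lebesgue measure on half-open intervals, and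
    uniqueness applies. *)
Lemma lebesgue_measure_affine (c p : R) (B : set R) : 0 < p -> measurable B ->
  mu ((fun u : R => (u - c) / p) @^-1` B) = (p%:E * mu B)%E.
Proof.
move=> p0 mB; pose f : R -> measurableTypeR R := fun u => (u - c) / p.
have mf : measurable_fun [set: measurableTypeR R] f.
  by apply: measurable_funM => //; exact: measurable_funB.
have pV0 : 0 <= p^-1 by rewrite invr_ge0 ltW.
have E : mu B = pushforward (mscale (NngNum pV0) mu) f B.
  apply: lebesgue_measure_unique => //= _ [[a b]] _ <-.
  rewrite /pushforward /mscale/=.
  have -> : f @^-1` [set` `]a, b]] = [set` `](c + p * a), (c + p * b)]].
    apply/seteqP; split => u; rewrite /f/= !in_itv/= ltr_pdivlMr// ler_pdivrMr//;
      by rewrite ltrBrDl lerBlDl ![p * _]mulrC.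
  rewrite !lebesgue_measure_itv/= !lte_fin ltrD2l ltr_pM2l//.
  case: ifPn => [ab|_]; last by rewrite mule0.
  by rewrite -EFinM -EFinB; congr (_%:E); field; rewrite gt_eqF.
by rewrite E /pushforward /mscale/= muleA -EFinM divff ?gt_eqF// mul1e.
Qed.

Definition unit_interval_prob : set (measurableTypeR R) -> \bar R :=
  mrestr mu (@measurable_itv R `[0, 1[%R).

HB.instance Definition _ := Measure.on unit_interval_prob.

Let unit_interval_prob_setT : unit_interval_prob setT = 1%E.
Proof.
by rewrite /unit_interval_prob /mrestr setTI lebesgue_measure_itv/= lte_fin ltr01 oppr0 adde0.
Qed.

HB.instance Definition _ := @Measure_isProbability.Build _ _ R
  unit_interval_prob unit_interval_prob_setT.

End affine_measure.

Section digits.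
Variables (R : realType) (p : nat -> R).
Hypothesis p_ge0 : forall k, 0 <= p k.
Hypothesis p_sum1 : series p @ \oo --> (1 : R).
Local Notation Q := (@unit_interval_prob R).

Let cell k : set R := [set u | series p k <= u < series p k.+1].

(* Junk value 0 when u is outside [0, 1). *)
Definition digit (u : R) : nat := xget 0%N [set k | series p k <= u < series p k.+1].

(** The affine map of the cell of [u] onto [0, 1). On [0, 1) the divisor is positive, since a cell
    of length 0 is empty. *)
Definition digit_shift (u : R) : R := (u - series p (digit u)) / p (digit u).

Let nondec : {homo series p : m n / (m <= n)%N >-> m <= n}.
Proof.
move=> m n mn; rewrite /series/= (@big_cat_nat _ _ _ m 0 n)//= lerDl.
by rewrite sumr_ge0.
Qed.

Let cell_digit k u : cell k u -> digit u = k.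
Proof.
move=> kcell; rewrite /digit; case: xgetP => [i _ /= icell|/(_ k)//].
move: kcell icell => /andP[k1 k2] /andP[i1 i2].
apply/eqP; rewrite eqn_leq; apply/andP; split; rewrite leqNgt; apply/negP => ik.
  by have := lt_le_trans k2 (le_trans (nondec ik) i1); rewrite ltxx.
by have := lt_le_trans i2 (le_trans (nondec ik) k1); rewrite ltxx.
Qed.

Let digit_cell u : 0 <= u < 1 -> cell (digit u) u.
Proof.
move=> /andP[u0 u1]; rewrite /digit; case: xgetP => [i _ //|none].
have all_le n : series p n <= u.
  elim: n => [|n IHn]; first by rewrite /series/= big_geq.
  by rewrite leNgt; apply/negP => un; apply: (none n); rewrite /= IHn.
suff : 1 <= u by rewrite leNgt u1.
by apply: (cvgr_to_le p_sum1); exact: nearW.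
Qed.

Let measurable_cell k : measurable (cell k : set (measurableTypeR R)).
Proof.
rewrite (_ : cell k = [set` `[series p k, series p k.+1[%R]); first exact: measurable_itv.
by apply/seteqP; split => u; rewrite /cell/= in_itv.
Qed.

Lemma measurable_digit : measurable_fun [set: measurableTypeR R] digit.
Proof.
move=> _ A _; rewrite setTI.
pose U := \bigcup_k cell k.
have mU : measurable (U : set (measurableTypeR R)) by apply: bigcupT_measurable.
rewrite (_ : digit @^-1` A = (\bigcup_(k in A) cell k) `|`
    (if 0%N \in A then ~` U else set0)).
  apply: measurableU; first by apply: bigcup_measurable => k _.
  by case: ifP => _; [exact: measurableC|exact: measurable0].
apply/seteqP; split => u /=.
  move=> Au; have [[k _ ku]|nU] := pselect (U u).
    by left; exists k => //; rewrite -(cell_digit ku).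
  right; suff d0 : digit u = 0%N by rewrite -d0 mem_set.
  by rewrite /digit; case: xgetP => // i _ iu; case: nU; exists i.
move=> [[k Ak /cell_digit ->//]|].
case: ifPn => // /set_mem A0 nU.
rewrite (_ : digit u = 0%N)// /digit; case: xgetP => // i _ iu.
by case: nU; exists i.
Qed.

Lemma measurable_digit_shift :
  measurable_fun [set: measurableTypeR R] (digit_shift : R -> measurableTypeR R).
Proof.
apply: (@measurable_nat_glue _ (measurableTypeR R) _ (measurableTypeR R) digit
  (fun k u => (u - series p k) / p k)); first exact: measurable_digit.
by move=> k; apply: measurable_funM => //; exact: measurable_funB.
Qed.

(** On the k-th cell the shift is affine of slope 1 / p k. This gives at once the law of the digit,
    the uniformity of the remainder and their independence. *)
Lemma digit_independent k (B : set (measurableTypeR R)) : measurable B ->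
  Q (digit @^-1` [set k] `&` digit_shift @^-1` B) = ((p k)%:E * Q B)%E.
Proof.
move=> mB.
have D01 : [set` `[0, 1[%R] = [set u : R | 0 <= u < 1].
  by apply/seteqP; split => u; rewrite /= in_itv.
rewrite /unit_interval_prob /mrestr D01.
have [pk0|pk0] := eqVneq (p k) 0.
  rewrite pk0 mul0e (_ : _ `&` _ = set0) ?measure0//.
  apply/seteqP; split => // u [[/= du _]] /digit_cell; rewrite /cell/= du.
  rewrite /series/= big_nat_recr//= pk0 addr0 => /andP[h1 h2].
  by have := le_lt_trans h1 h2; rewrite ltxx.
have {}pk0 : 0 < p k by rewrite lt_def pk0 p_ge0.
have mD : measurable (B `&` [set u : R | 0 <= u < 1]).
  by rewrite -D01; apply: measurableI => //; exact: measurable_itv.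
rewrite -(lebesgue_measure_affine (series p k) pk0 mD); congr (lebesgue_measure _).
have cellE u : (0 <= (u - series p k) / p k < 1) = (series p k <= u < series p k.+1).
  rewrite ler_pdivlMr// mul0r subr_ge0 ltr_pdivrMr// mul1r ltrBlDl.
  by rewrite [in RHS]/series/= big_nat_recr.
have s0 : 0 <= series p k by rewrite /series/= sumr_ge0.
have s1 : series p k.+1 <= 1.
  apply: (cvgr_to_ge p_sum1); exists k.+1 => // n /= kn; exact: nondec.
apply/seteqP; split => u /=.
  move=> [[dk Bu] u01]; have := digit_cell u01; rewrite /cell/= dk => uk.
  by split; [move: Bu; rewrite /digit_shift dk|rewrite cellE].
rewrite cellE => -[Bu uk]; have dk := cell_digit uk.
split; first by split; [exact: dk|rewrite /digit_shift dk].
by case/andP: uk => u0 u1; rewrite (le_trans s0)//= (lt_le_trans u1).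
Qed.

End digits.

Section random_variable_of.
Context d (T : measurableType d) (R : realType) (P : probability T R).

Definition rv_of (f : T -> nat) (mf : measurable_fun setT f) : {RV P >-> nat} :=
  mfun_Sub (mem_set mf).

End random_variable_of.

Section digit_sequence.
Variables (R : realType) (p_ : nat -> nat -> R).
Hypothesis p_ge0 : forall n k, 0 <= p_ n k.
Hypothesis p_sum1 : forall n, series (p_ n) @ \oo --> (1 : R).
Local Notation Q := (@unit_interval_prob R).
Local Notation Omega := (measurableTypeR R).

(* The n-th digit is taken with respect to the n-th law, so that the Poisson
   variable and the jumps come from a single point. *)
Fixpoint digit_tail (n : nat) : Omega -> Omega :=
  if n is m.+1 then digit_shift (p_ m) \o digit_tail m else id.

Definition digit_seq (n : nat) : Omega -> nat := digit (p_ n) \o digit_tail n.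

Lemma measurable_digit_tail n : measurable_fun setT (digit_tail n).
Proof.
elim: n => [|n IHn] /=; first exact: measurable_id.
by apply: measurableT_comp => //; exact: (measurable_digit_shift (p_ge0 n)).
Qed.

Lemma measurable_digit_seq n : measurable_fun setT (digit_seq n).
Proof.
apply: measurableT_comp; last exact: measurable_digit_tail.
exact: (measurable_digit (p_ge0 n)).
Qed.

Let digit_split n (A : set nat) (B : set Omega) : measurable B ->
  (Q (digit (p_ n) @^-1` A `&` digit_shift (p_ n) @^-1` B) =
   Q (digit (p_ n) @^-1` A) * Q B)%E.
Proof.
move=> mB; have md := measurable_digit (p_ge0 n).
have QA (C : set Omega) : measurable C ->
    (Q (digit (p_ n) @^-1` A `&` digit_shift (p_ n) @^-1` C) =
     \sum_(0 <= k <oo) ((\1_A k * p_ n k)%:E * Q C))%E.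
  move=> mC.
  have mSC : measurable (digit_shift (p_ n) @^-1` C).
    rewrite -[X in measurable X]setTI.
    exact: (measurable_digit_shift (p_ge0 n)).
  have mA : measurable (digit (p_ n) @^-1` A) by exact: measurable_nat_preimage.
  have := @integral_nat_split _ _ _ Q (digit (p_ n)) _ (cst 1) (\1_A : nat -> R) md mSC
    (measurable_cst _) (fun=> ler01).
  under eq_integral do rewrite mul1r.
  rewrite (integral_indic Q mSC mA) => ->; last by move=> k; rewrite indicE.
  apply: eq_eseriesr => k _; rewrite EFinM -muleA; congr (_ * _)%E.
  have mSk : measurable (digit_shift (p_ n) @^-1` C `&` digit (p_ n) @^-1` [set k]).
    by apply: measurableI => //; exact: measurable_nat_preimage.
  have := integral_cst Q mSk 1%E; rewrite mul1e => ->.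
  rewrite setIC; exact: (digit_independent (p_ge0 n) (p_sum1 n) k mC).
have := QA setT measurableT; rewrite preimage_setT setIT probability_setT => ->.
rewrite QA//.
have QB : Q B = (fine (Q B))%:E by rewrite fineK// fin_num_measure.
rewrite QB; under eq_eseriesr do rewrite muleC.
rewrite nneseriesZl; last by move=> k _; rewrite lee_fin mulr_ge0// indicE.
by rewrite muleC; congr (_ * _)%E; apply: eq_eseriesr => k _; rewrite mule1.
Qed.

(** After [n] digits the remainder is still uniform and independent of them. The set [B] is general
    because the next digit and the next remainder are both functions of the current remainder. *)
Let digit_seq_tail (A : nat -> set nat) n (B : set Omega) : measurable B ->
  (Q (\big[setI/setT]_(0 <= i < n) (digit_seq i @^-1` A i) `&` digit_tail n @^-1` B) =
   (\prod_(0 <= i < n) Q (digit (p_ i) @^-1` A i)) * Q B)%E.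
Proof.
elim: n B => [|n IHn] B mB; first by rewrite !big_geq// setTI mul1e.
rewrite !big_nat_recr//= -setIA.
have -> : digit_seq n @^-1` A n `&` (digit_shift (p_ n) \o digit_tail n) @^-1` B =
  digit_tail n @^-1` (digit (p_ n) @^-1` A n `&` digit_shift (p_ n) @^-1` B).
  by [].
rewrite IHn.
  by rewrite digit_split// muleA.
apply: measurableI; first exact: (measurable_nat_preimage _ (measurable_digit (p_ge0 n))).
by rewrite -[X in measurable X]setTI; exact: (measurable_digit_shift (p_ge0 n)).
Qed.

Lemma digit_seq_law n (A : set nat) :
  Q (digit_seq n @^-1` A) = Q (digit (p_ n) @^-1` A).
Proof.
have mA : measurable (digit (p_ n) @^-1` A : set Omega).
  exact: (measurable_nat_preimage _ (measurable_digit (p_ge0 n))).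
have := digit_seq_tail (fun=> setT) n mA.
rewrite big1; last by move=> i _; rewrite preimage_setT.
rewrite big1; last by move=> i _; rewrite preimage_setT probability_setT.
by rewrite setTI mul1e.
Qed.

Lemma digit_seq_pmf n k : Q (digit_seq n @^-1` [set k]) = (p_ n k)%:E.
Proof.
rewrite digit_seq_law; have := digit_independent (p_ge0 n) (p_sum1 n) k measurableT.
by rewrite preimage_setT setIT probability_setT mule1.
Qed.

Lemma digit_seq_prefix (A : nat -> set nat) n :
  (Q (\big[setI/setT]_(0 <= i < n) (digit_seq i @^-1` A i)) =
   \prod_(0 <= i < n) Q (digit_seq i @^-1` A i))%E.
Proof.
have := digit_seq_tail A n measurableT.
rewrite preimage_setT setIT probability_setT mule1 => ->.
by apply: eq_bigr => i _; rewrite digit_seq_law.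
Qed.

Definition digit_rv n : {RV Q >-> nat} := rv_of Q (measurable_digit_seq n).

Lemma digit_rv_independent (I : choiceType) (idx : I -> nat) : injective idx ->
  mutually_independent (fun i => digit_rv (idx i)).
Proof.
move=> inj J A uJ _.
(* Constraints on selected digits become constraints on an initial segment, with [setT] at the
   unselected positions. *)
pose B n := if [pick i : seq_sub J | idx (val i) == n] is Some i then A (val i) else setT.
have BA i : i \in J -> B (idx i) = A i.
  move=> iJ; rewrite /B; case: pickP => [j /eqP/inj ->//|/(_ (SeqSub iJ))].
  by rewrite /= eqxx.
have BT n : n \notin map idx J -> B n = setT.
  move=> nJ; rewrite /B; case: pickP => // j /eqP jn.
  by case/negP: nJ; rewrite -jn map_f// ssvalP.
pose m := (\max_(i <- J) idx i).+1.
have lem i : i \in J -> (idx i < m)%N.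
  by move=> iJ; rewrite ltnS; exact: leq_bigmax_seq.
have perm : perm_eq [seq n <- index_iota 0 m | n \in map idx J] (map idx J).
  apply: uniq_perm; rewrite ?filter_uniq ?iota_uniq ?map_inj_uniq// => n.
  rewrite mem_filter mem_index_iota/=; apply/andb_idr => /mapP[i iJ ->].
  exact: lem.
have := digit_seq_prefix B m.
have -> : \big[setI/setT]_(0 <= n < m) (digit_seq n @^-1` B n) =
    \bigcap_(i in [set` J]) (digit_seq (idx i) @^-1` A i).
  rewrite (bigID (fun n => n \in map idx J))/= [X in _ `&` X]big1 ?setIT; last first.
    by move=> n nJ; rewrite BT.
  rewrite -big_filter (perm_big _ perm) big_map bigcap_seq.
  by apply: eq_big_seq => i iJ; rewrite BA.
move=> E; transitivity (\prod_(0 <= n < m) Q (digit_seq n @^-1` B n))%E; first exact: E.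
rewrite (bigID (fun n => n \in map idx J))/= [X in (_ * X)%E]big1 ?mule1; last first.
  by move=> n nJ; rewrite BT// preimage_setT probability_setT.
rewrite -big_filter (perm_big _ perm) big_map.
by apply: eq_big_seq => i iJ; rewrite BA.
Qed.

End digit_sequence.

(** * Compound Poisson laws *)

Lemma compound_sum_pgf d (T : measurableType d) (R : realType) (P : probability T R)
    (Z : nat -> {RV P >-> nat}) (N : {RV P >-> nat}) (s : R) :
  mutually_independent (fun i : option nat => if i is Some j then Z j else N) ->
  (forall i, same_law P P (Z i) (Z 0%N)) -> 0 <= s <= 1 ->
  rv_pgf P (fun w => (\sum_(i < N w) Z i w)%N) s = rv_pgf P N (rv_pgf P (Z 0%N) s).
Proof.
move=> indep ident s01; have /andP[s0 s1] := s01.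
have mS : measurable_fun setT (fun w => (\sum_(i < N w) Z i w)%N).
  exact: (measurable_random_sum (measurable_funPT N) (fun j => measurable_funPT (Z j))).
have [gE /andP[g0 g1]] := rv_pgfE P (measurable_funPT (Z 0%N)) s01.
set g := rv_pgf P (Z 0%N) s in gE g0 g1 *.
have g01 : 0 <= g <= 1 by rewrite g0.
apply: EFin_inj; rewrite -(rv_pgfE P mS s01).1 -(rv_pgfE P (measurable_funPT N) g01).1.
pose phi w := s ^+ (\sum_(i < N w) Z i w)%N.
have mphi : measurable_fun setT phi by exact: (measurable_real_comp (GRing.exp s) mS).
have phi0 w : 0 <= phi w by rewrite exprn_ge0.
have := @expectation_nat_split _ _ _ P N phi (fun=> 1) (measurable_funPT N) mphi phi0
  (fun=> ler01).
under eq_fun do rewrite mulr1; rewrite /phi => ->.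
rewrite (@expectation_nat _ _ _ P N (GRing.exp g) (measurable_funPT N)); last first.
  by move=> k; rewrite exprn_ge0.
apply: eq_eseriesr => k _; rewrite mul1e.
(* The index [None] carries the indicator of [N = k], so conditioning on [N] is again an expectation
   of an independent product. *)
pose v (i : option nat) : nat -> R :=
  if i is Some _ then GRing.exp s else fun m => (m == k)%:R.
have v0 i m : 0 <= v i m by case: i => [j|] /=; [rewrite exprn_ge0|].
have v1 i m : v i m <= 1.
  by case: i => [j|] /=; [rewrite exprn_ile1|case: (m == k); rewrite ?lexx ?ler01].
have iotaS' m : iota 0 m.+1 = iota 0 m ++ [:: m] by rewrite -addn1 iotaD.
pose J := None :: [seq Some j | j <- iota 0 k].
have uJ : uniq J.
  rewrite /J/= map_inj_uniq ?iota_uniq ?andbT; last by move=> i j [].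
  by apply/mapP => -[].
have := independent_expectation_prod indep v0 v1 uJ.
have mNk : measurable (N @^-1` [set k]) by exact: measurable_nat_preimage.
rewrite [in RHS]big_cons/= big_map => E.
transitivity (P (N @^-1` [set k]) * \prod_(j <- iota 0 k) 'E_P[fun w => (s ^+ Z j w)%R])%E.
  have <- : ('E_P[fun w => ((N w == k)%:R)%R] = P (N @^-1` [set k]))%E.
    rewrite -(expectation_indic P mNk); congr expectation; apply/funext => w.
    rewrite indicE; congr (_%:R); case: eqP => [e|ne]; first by rewrite mem_set.
    by rewrite memNset.
  rewrite -E expectation.unlock [in LHS]integral_mkcond; apply: eq_integral => w _.
  rewrite big_cons/= big_map patchE; case: ifPn => [/set_mem e|/negP ne].
    rewrite (e : N w = k) eqxx mul1r; congr (_%:E).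
    elim: (k) => [|m IHm]; first by rewrite big_ord0 big_nil.
    by rewrite iotaS' big_cat big_seq1 big_ord_recr exprD IHm.
  case: eqP => [e|_]; first by case: ne; rewrite inE.
  by rewrite mul0r.
rewrite muleC; congr (_ * _)%E.
elim: (k) => [|m IHm]; first by rewrite big_nil.
rewrite iotaS' big_cat big_seq1 IHm exprSr EFinM; congr (_ * _)%E.
by rewrite -gE; apply: same_law_expectation => // i; rewrite exprn_ge0.
Qed.

Section compound_poisson_existence.
Variables (R : realType) (rate : R) (p : nat -> R) (g : R -> R).
Hypothesis rate_ge0 : 0 <= rate.
Hypothesis p_ge0 : forall k, 0 <= p k.
Hypothesis p_sum1 : series p @ \oo --> (1 : R).
Hypothesis p_pgf : forall s : R, 0 <= s <= 1 -> series (fun k => p k * s ^+ k) @ \oo --> g s.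

Let q (k : nat) : R := fine (poisson_prob rate 0 [set k]).

Let qE k : poisson_prob rate 0 [set k] = (q k)%:E.
Proof. by rewrite fineK// fin_num_measure. Qed.

Let q_ge0 k : 0 <= q k.
Proof. by rewrite -lee_fin -qE. Qed.

Let nat_measureE (mu : {measure set nat -> \bar R}) (A : set nat) :
  (mu A = \sum_(0 <= k <oo | k \in A) mu [set k])%E.
Proof.
rewrite -measure_bigcup//.
  by congr (mu _); apply/seteqP; split => [k Ak|k [i Ai /= ->]//]; exists k.
by apply/trivIsetP => i j _ _ ij; apply/seteqP; split => // k [/= ki kj]; move: ij; rewrite -ki kj eqxx.
Qed.

Let q_sum1 : series q @ \oo --> (1 : R).
Proof.
apply: eseries_EFin_cvg => //.
have T1 : poisson_prob rate 0 setT = 1%E := probability_setT (poisson_prob rate 0).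
rewrite -T1; etransitivity; last exact/esym/nat_measureE.
rewrite [in RHS]eseries_mkcond; apply: eq_eseriesr => k _.
by rewrite in_setT; exact/esym/qE.
Qed.

Let q_exp (x : R) : 0 <= x <= 1 ->
  series (fun k => q k * x ^+ k) @ \oo --> expR (rate * x - rate).
Proof.
(* At rate 0 the Poisson law is a Dirac mass by definition, so the exponential series is used only
   for positive rate. *)
move=> /andP[x0 x1]; move: rate_ge0; rewrite le_eqVlt => /predU1P[r0|r0].
  rewrite -r0 mul0r subrr expR0.
  rewrite (_ : series _ = series q) //.
  apply/funext => n; rewrite /series/=; apply: eq_bigr => k _.
  rewrite /q /poisson_prob -r0 ltxx /dirac/= indicE.
  case: k => [|k]; first by rewrite expr0 mulr1.
  by rewrite memNset//= mul0r.
have -> : series (fun k => q k * x ^+ k) =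
    (fun n => expR (- rate) * series (exp_coeff (rate * x)) n).
  apply/funext => n; rewrite /series/= mulr_sumr; apply: eq_bigr => k _.
  rewrite /q /poisson_prob r0 esum_set1; last by rewrite lee_fin poisson_pmf_ge0.
  by rewrite /= /poisson_pmf r0 /exp_coeff /= exprMn; ring.
rewrite addrC expRD; apply: cvgMl_tmp.
exact: is_cvg_series_exp_coeff.
Qed.

Let laws (n : nat) : nat -> R := if n is 0 then q else p.

Let laws_ge0 n k : 0 <= laws n k.
Proof. by case: n. Qed.

Let laws_sum1 n : series (laws n) @ \oo --> (1 : R).
Proof. by case: n. Qed.

Lemma compound_poisson_exists :
  exists (d' : measure_display) (T' : measurableType d') (P : probability T' R)
    (Y : {RV P >-> nat}),
    compound_poisson P Y /\
    forall s : R, 0 <= s <= 1 -> pgf P Y s = (expR (rate * g s - rate))%:E.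
Proof.
pose D := digit_rv laws_ge0.
pose N := D 0%N; pose Z n := D n.+1.
pose Q : probability (measurableTypeR R) R := @unit_interval_prob R.
have mY : measurable_fun setT (fun w => (\sum_(i < N w) Z i w)%N).
  exact: (measurable_random_sum (measurable_funPT N) (fun j => measurable_funPT (Z j))).
pose idx (i : option nat) : nat := if i is Some j then j.+1 else 0%N.
have idx_inj : injective idx by move=> [i|] [j|] //= [->].
have indep : mutually_independent (fun i : option nat => if i is Some j then Z j else N).
  have := digit_rv_independent laws_ge0 laws_sum1 idx_inj.
  by congr mutually_independent; apply/funext => -[].
have ident i : same_law Q Q (Z i) (Z 0%N).
  move=> A _; transitivity (Q (digit p @^-1` A)).
    exact: (digit_seq_law laws_ge0 laws_sum1 i.+1 A).
  exact/esym/(digit_seq_law laws_ge0 laws_sum1 1 A).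
exists _, (measurableTypeR R), Q, (rv_of Q mY); split.
  exists _, (measurableTypeR R), Q, Z, N, rate; split => //.
  move=> A; rewrite nat_measureE [RHS]nat_measureE; apply: eq_eseriesr => k _.
  transitivity (q k)%:E; last exact/esym/qE.
  exact: (digit_seq_pmf laws_ge0 laws_sum1 0 k).
move=> s s01; have /andP[s0 s1] := s01.
transitivity (rv_pgf Q (rv_of Q mY) s)%:E.
  exact: (rv_pgfE Q mY s01).1.
congr (_%:E).
transitivity (rv_pgf Q (fun w => (\sum_(i < N w) Z i w)%N) s); first by [].
rewrite compound_sum_pgf//.
have series_rv n (u l : R) : 0 <= u <= 1 ->
    series (fun k => laws n k * u ^+ k) @ \oo --> l -> rv_pgf Q (D n) u = l.
  move=> u01 lcvg; have /andP[u0 u1] := u01.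
  apply: EFin_inj; rewrite -(rv_pgfE Q (measurable_funPT (D n)) u01).1.
  rewrite (@expectation_nat _ _ _ Q (D n) (GRing.exp u) (measurable_funPT (D n))); last first.
    by move=> k; rewrite exprn_ge0.
  rewrite -(cvg_eseries_EFin lcvg); apply: eq_eseriesr => k _.
  rewrite mulrC EFinM; congr (_ * _)%E.
  exact: (digit_seq_pmf laws_ge0 laws_sum1 n k).
have gE : rv_pgf Q (Z 0%N) s = g s by apply: series_rv => //; exact: p_pgf.
have [_ g01] := rv_pgfE Q (measurable_funPT (Z 0%N)) s01.
rewrite gE in g01 *; apply: series_rv => //; exact: q_exp.
Qed.

End compound_poisson_existence.

(** * Asymptotic expansions *)

(** The assumptions are limits of extended reals: a finite limit makes the moments finite from some
    index on, after which the ratio is one of reals. *)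
Lemma ereal_ratio_cvg (R : realType) (F : nat -> \bar R) (r : nat -> R) (l : R) :
  (forall n, 0 <= F n)%E -> (forall n, 0 < r n) ->
  (F n / (r n)%:E)%E @[n --> \oo] --> l%:E ->
  (\forall n \near \oo, F n \is a fin_num) /\ fine (F n) / r n @[n --> \oo] --> l.
Proof.
move=> F0 r0 /fine_cvgP[fin cvg].
have FE n : (F n / (r n)%:E)%E \is a fin_num -> F n \is a fin_num.
  rewrite inver gt_eqF//; move: (F0 n); case: (F n) => // _.
  by rewrite gt0_mulye// lte_fin invr_gt0.
have Ffin : \forall n \near \oo, F n \is a fin_num.
  by apply: filterS fin => n; exact: FE.
split => //; apply: cvg_trans cvg; apply: near_eq_cvg.
apply: filterS Ffin => n Fn.
by rewrite /= inver gt_eqF// fineM.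
Qed.

Section expansions.
Context (R : realType) d (T : measurableType d) (P : probability T R).
Variables (xi0 eps : nat -> {RV P >-> nat}) (a : nat -> R).
Hypothesis a_gt0 : forall n, 0 < a n.
Hypothesis meanE : forall n, mean P (xi0 n) = (1 - a n)%:E.

Let mX (X : nat -> {RV P >-> nat}) n : measurable_fun setT (X n : T -> nat) :=
  measurable_funPT (X n).

Lemma mean_factorial_moment (X : T -> nat) : mean P X = factorial_moment P X 1.
Proof.
by rewrite /mean /factorial_moment; under [in RHS]eq_fun do rewrite ffactn1.
Qed.

Lemma factorial_moment0 (X : T -> nat) : factorial_moment P X 0 = 1%E.
Proof.
rewrite /factorial_moment; under eq_fun do rewrite ffactn0.
exact: expectation_cst.
Qed.

Let fin0 (X : T -> nat) : factorial_moment P X 0 \is a fin_num.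
Proof. by rewrite factorial_moment0. Qed.

Let fin1 n : factorial_moment P (xi0 n) 1 \is a fin_num.
Proof. by rewrite -mean_factorial_moment meanE. Qed.

Let binom1 n : binom_moment P (xi0 n) 1 = 1 - a n.
Proof.
apply: EFin_inj; rewrite -factorial_moment_fin//.
by have := factorial_momentE P (mX xi0 n) 1; rewrite mul1e -mean_factorial_moment meanE => ->.
Qed.

Lemma offspring_mean_bound n (x : R) : 0 <= x <= 1 ->
  1 - rv_pgf P (xi0 n) (1 - x) <= (1 - a n) * x.
Proof.
move=> x01.
have := @rv_pgf_bonferroni _ _ _ P _ (mX xi0 n) 1 x _ x01.
rewrite big_nat1 expr0 expr1 binom_moment0 !mul1r binom1 ler_norml => /(_ _)/andP[|h _].
  by move=> [|[|k]].
lra.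
Qed.

Lemma offspring_expansion (nu : R) : 0 <= nu ->
  (factorial_moment P (xi0 n) 2 / (1 - mean P (xi0 n)))%E @[n --> \oo] --> nu%:E ->
  (0 < nu ->
    (factorial_moment P (xi0 n) 3 / (1 - mean P (xi0 n)))%E @[n --> \oo] --> 0%E) ->
  forall e : R, 0 < e -> \forall n \near \oo, forall x : R, 0 <= x <= 1 ->
    `|1 - rv_pgf P (xi0 n) (1 - x) - x + a n * (x + nu / 2 * x ^+ 2)| <= e * (a n * x).
Proof.
have mean' n : (1 - mean P (xi0 n) = (a n)%:E)%E.
  by rewrite meanE -EFinB; congr (_%:E); ring.
move=> nu0; under eq_fun do rewrite mean'.
move=> /(ereal_ratio_cvg (fun n => factorial_moment_ge0 P _ _) a_gt0)[fin2 c2] C3 e e0.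
have e20 : 0 < e / 2 by rewrite divr_gt0.
have near2 : \forall n \near \oo, `|binom_moment P (xi0 n) 2 - nu / 2 * a n| <= e / 2 * a n.
  move/cvgrPdistC_le : c2 => /(_ _ e0) c2.
  near=> n.
  have F2 : factorial_moment P (xi0 n) 2 \is a fin_num by near: n.
  have : `|fine (factorial_moment P (xi0 n) 2) / a n - nu| <= e by near: n.
  rewrite fine_factorial_moment// => h.
  rewrite [X in `|X|](_ : _ = (2 * binom_moment P (xi0 n) 2 / a n - nu) * (a n / 2)).
    rewrite normrM [X in _ * X]gtr0_norm ?divr_gt0//.
    have -> : e / 2 * a n = e * (a n / 2) by ring.
    by rewrite ler_wpM2r// divr_ge0// ltW.
  by field; rewrite gt_eqF.
have m2ge n : 0 <= binom_moment P (xi0 n) 2.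
  by apply: fine_ge0; apply: expectation_ge0 => w.
(* For nu = 0 the second moment is already o(a_n), so the expansion of order 2 suffices; otherwise
   the second moment is kept as main term and the third bounds the remainder. *)
move: nu0; rewrite le_eqVlt => /predU1P[nu0|nu0].
  have : \forall n \near \oo, `|binom_moment P (xi0 n) 2| <= e / 2 * a n.
    apply: filterS near2 => n; rewrite -nu0 !mul0r subr0; exact.
  apply: filterS2 fin2 => n F2 h x x01; have /andP[x0 x1] := x01.
  have := @rv_pgf_bonferroni _ _ _ P _ (mX xi0 n) 2 x _ x01.
  rewrite big_nat_recr//= big_nat1 expr0 !expr1 binom_moment0 !mul1r binom1 => /(_ _) B.
  rewrite -nu0 !mul0r addr0 [X in `|X|](_ : _ = - (rv_pgf P (xi0 n) (1 - x) -
    (1 + -1 * (1 - a n) * x))); last by ring.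
  rewrite normrN (le_trans (B _))//; first by move=> [|[|[|k]]].
  rewrite ger0_norm// in h.
  rewrite (le_trans (ler_wpM2r _ h)) ?exprn_ge0// mulrA.
  have an0 := ltW (a_gt0 n).
  apply: ler_pM; rewrite ?exprn_ge0//.
  - by rewrite mulr_ge0// ltW.
  - by rewrite ler_wpM2r// ler_pdivrMr// ler_peMr ?ler1n// ltW.
  - by rewrite expr2 ler_piMr.
have := C3 nu0; under eq_fun do rewrite mean'.
move=> /(ereal_ratio_cvg (fun n => factorial_moment_ge0 P _ _) a_gt0)[fin3 c3].
have near3 : \forall n \near \oo, binom_moment P (xi0 n) 3 <= e / 2 * a n.
  move/cvgrPdistC_le : c3 => /(_ _ e20) c3.
  near=> n.
  have F3 : factorial_moment P (xi0 n) 3 \is a fin_num by near: n.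
  have : `|fine (factorial_moment P (xi0 n) 3) / a n - 0| <= e / 2 by near: n.
  rewrite fine_factorial_moment// subr0 ler_norml => /andP[_].
  rewrite ler_pdivrMr//; apply: le_trans.
  rewrite ler_peMl ?ler1n//.
  by apply: fine_ge0; apply: expectation_ge0 => w.
near=> n => x x01; have /andP[x0 x1] := x01.
have F2 : factorial_moment P (xi0 n) 2 \is a fin_num by near: n.
have F3 : factorial_moment P (xi0 n) 3 \is a fin_num by near: n.
have h2 : `|binom_moment P (xi0 n) 2 - nu / 2 * a n| <= e / 2 * a n by near: n.
have h3 : binom_moment P (xi0 n) 3 <= e / 2 * a n by near: n.
have := @rv_pgf_bonferroni _ _ _ P _ (mX xi0 n) 3 x _ x01.
rewrite !big_nat_recr//= big_geq// add0r expr0 !expr1 binom_moment0 !mul1r binom1 => /(_ _) B.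
rewrite [X in `|X|](_ : _ = - (rv_pgf P (xi0 n) (1 - x) -
  (1 + -1 * (1 - a n) * x + (-1) ^+ 2 * binom_moment P (xi0 n) 2 * x ^+ 2))
  - (binom_moment P (xi0 n) 2 - nu / 2 * a n) * x ^+ 2); last by field.
rewrite (le_trans (ler_normB _ _))// normrN normrM.
have -> : e * (a n * x) = e / 2 * a n * x + e / 2 * a n * x by field.
have ea : 0 <= e / 2 * a n by rewrite mulr_ge0// ltW.
apply: lerD.
  rewrite (le_trans (B _))//; first by move=> [|[|[|[|k]]]].
  rewrite (le_trans (ler_wpM2r _ h3)) ?exprn_ge0// ler_wpM2l//.
  by rewrite exprS ler_piMr// exprn_ile1.
rewrite (le_trans (ler_wpM2r _ h2))// ler_wpM2l// ger0_norm ?exprn_ge0//.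
by rewrite expr2 ler_piMr.
Unshelve. all: by end_near. Qed.

Section immigration.
Variables (K : nat) (lambda : nat -> R).
Hypothesis K_gt0 : (0 < K)%N.
Hypothesis immigration : forall k, (1 <= k <= K)%N ->
    (factorial_moment P (eps n) k / ((k`!)%:R%:E * (1 - mean P (xi0 n))))%E
      @[n --> \oo] --> (lambda k)%:E.
Hypothesis lambda_K : lambda K = 0.

Let binom_cvg k : (1 <= k <= K)%N ->
  (\forall n \near \oo, factorial_moment P (eps n) k \is a fin_num) /\
  binom_moment P (eps n) k / a n @[n --> \oo] --> lambda k.
Proof.
move=> /immigration.
have mean' n : ((k`!)%:R%:E * (1 - mean P (xi0 n)) = (k`!%:R * a n)%:E)%E.
  by rewrite meanE -EFinB -EFinM; congr (_%:E); ring.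
under eq_fun do rewrite mean'.
have r0 n : 0 < k`!%:R * a n by rewrite mulr_gt0// ltr0n fact_gt0.
move=> /(ereal_ratio_cvg (fun n => factorial_moment_ge0 P _ _) r0)[fin c].
split => //; apply: cvg_trans c; apply: near_eq_cvg.
apply: filterS fin => n F; rewrite fine_factorial_moment//.
by field; rewrite gt_eqF//= pnatr_eq0 -lt0n fact_gt0.
Qed.

Let near_fin : \forall n \near \oo, forall k, (k <= K)%N ->
  factorial_moment P (eps n) k \is a fin_num.
Proof.
suff H M : (M <= K)%N -> \forall n \near \oo, forall k, (k <= M)%N ->
  factorial_moment P (eps n) k \is a fin_num by exact: H (leqnn K).
elim: M => [_|M IHM MK].
  by near=> n => k; rewrite leqn0 => /eqP ->.
have [fM _] := binom_cvg (k := M.+1) MK.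
apply: filterS2 (IHM (ltnW MK)) fM => n h1 h2 k.
by rewrite leq_eqVlt => /predU1P[->//|]; exact: h1.
Unshelve. all: by end_near. Qed.

Lemma immigration_expansion (e : R) : 0 < e ->
  \forall n \near \oo, forall x : R, 0 <= x <= 1 ->
  `|rv_pgf P (eps n) (1 - x) - 1 - a n * (x * immigration_slope K lambda x)|
    <= e * (a n * x).
Proof.
move=> e0.
(* The summand with [k.+1 = K] is the Bonferroni remainder over a_n, because [lambda K] is 0; the
   others are the coefficient errors. *)
pose err n := \sum_(0 <= k < K) `|binom_moment P (eps n) k.+1 / a n - lambda k.+1|.
have err0 : err @ \oo --> (0 : R).
  have -> : (0 : R) = \sum_(0 <= k < K) 0 by rewrite big1.
  apply: cvg_sum_nat => j jK.
  have [_ c] := binom_cvg (k := j.+1) jK.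
  have : `|binom_moment P (eps n) j.+1 / a n - lambda j.+1| @[n --> \oo] -->
      `|lambda j.+1 - lambda j.+1|.
    by apply: cvg_norm; apply: cvgB; [exact: c|exact: cvg_cst].
  by rewrite subrr normr0.
have nerr : \forall n \near \oo, err n <= e.
  apply: filterS (cvgr0_norm_le _ err0 _ e0) => n.
  by apply: le_trans; exact: ler_norm.
apply: filterS2 near_fin nerr => n fin en x x01; have /andP[x0 x1] := x01.
have B := rv_pgf_bonferroni (mX eps n) fin x01.
have an0 := a_gt0 n.
have [K' KE] : exists K', K = K'.+1 by exists K.-1; rewrite prednK.
move: B en lambda_K; rewrite /err KE => B en lK.
have -> : rv_pgf P (eps n) (1 - x) - 1 - a n * (x * immigration_slope K'.+1 lambda x) =
  (rv_pgf P (eps n) (1 - x) -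
    \sum_(0 <= k < K'.+1) (-1) ^+ k * binom_moment P (eps n) k * x ^+ k) +
  \sum_(0 <= k < K') (-1) ^+ k.+1 * (binom_moment P (eps n) k.+1 / a n - lambda k.+1)
     * (a n * x ^+ k.+1).
  rewrite big_nat_recl// binom_moment0 !expr0 !mul1r /immigration_slope big_add1/=.
  have -> : \sum_(0 <= k < K') (-1) ^+ k.+1 *
      (binom_moment P (eps n) k.+1 / a n - lambda k.+1) * (a n * x ^+ k.+1) =
    \sum_(0 <= k < K') (-1) ^+ k.+1 * binom_moment P (eps n) k.+1 * x ^+ k.+1 -
    a n * (x * \sum_(0 <= k < K') (-1) ^+ k.+1 * lambda k.+1 * x ^+ k).
    rewrite !mulr_sumr -sumrB; apply: eq_bigr => k _ /=.
    by rewrite (exprS x); field; rewrite gt_eqF.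
  by ring.
rewrite (le_trans (ler_normD _ _))//.
have ax0 : 0 <= a n * x by rewrite mulr_ge0// ltW.
have axk k : 0 <= a n * x ^+ k.+1 <= a n * x.
  rewrite mulr_ge0 ?exprn_ge0 ?(ltW an0)//= ler_pM2l//.
  by rewrite exprS ler_piMr// exprn_ile1.
apply: (le_trans _ (ler_wpM2r ax0 en)).
rewrite [in leRHS]big_nat_recr//= mulrDl addrC lerD//.
  rewrite (le_trans (ler_norm_sum _ _ _))// mulr_suml ler_sum// => k _.
  rewrite normrM normrM normrX normrN1 expr1n mul1r ler_wpM2l//.
  by have /andP[k0 k1] := axk k; rewrite ger0_norm.
rewrite (le_trans B)// lK subr0.
have b0 : 0 <= binom_moment P (eps n) K'.+1.
  by apply: fine_ge0; apply: expectation_ge0 => w.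
have -> : binom_moment P (eps n) K'.+1 * x ^+ K'.+1 =
   binom_moment P (eps n) K'.+1 / a n * (a n * x ^+ K'.+1) by field; rewrite gt_eqF.
have /andP[k0 k1] := axk K'.
by rewrite ger0_norm ?divr_ge0 ?(ltW an0)// ler_wpM2l// divr_ge0// ltW.
Qed.

(** A limit of nonnegative numbers: the truncated sum for P(eps_n = i) plus its remainder, over a_n.
    The remainder vanishes as lambda_K = 0, and for i > 0 the term k = 0, which would be 1 / a_n, is
    absent. *)
Lemma limit_jump_rate_ge0 i : (0 < i)%N -> 0 <= jump_rate K lambda i.
Proof.
move=> i0; have [iK|Ki] := ltnP i K; last first.
  rewrite /jump_rate big_nat big1// => k /andP[_ kK].
  by rewrite bin_small ?mulr0 ?mul0r// (leq_trans kK).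
pose b n := \sum_(1 <= k < K) (-1) ^+ (k + i) * 'C(k, i)%:R * (binom_moment P (eps n) k / a n).
pose r n := 'C(K, i)%:R * (binom_moment P (eps n) K / a n).
have cb : b n + r n @[n --> \oo] --> jump_rate K lambda i + 0.
  apply: cvgD; last first.
    rewrite -[X in _ --> X](mulr0 'C(K, i)%:R) -lambda_K.
    by apply: cvgMl_tmp; have [|_] := binom_cvg (k := K); rewrite ?K_gt0 ?leqnn.
  rewrite /b /jump_rate big_add1; under eq_fun do rewrite big_add1.
  apply: cvg_sum_nat => j jK; apply: cvgMl_tmp.
  have [|_] := binom_cvg (k := j.+1); last exact.
  by rewrite /= (leq_trans jK)// leq_pred.
rewrite -[leRHS]addr0; apply: (cvgr_to_ge cb).
apply: filterS near_fin => n fin.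
have := binom_moment_indicator (mX eps n) fin iK.
rewrite big_ltn// (@bin_small 0 i)// mulr0 mul0r add0r -subr_ge0 opprK => h.
have -> : b n + r n = (\sum_(1 <= k < K) (-1) ^+ (k + i) * 'C(k, i)%:R * binom_moment P (eps n) k
   + 'C(K, i)%:R * binom_moment P (eps n) K) / a n.
  by rewrite mulrDl mulr_suml /b /r mulrA; congr (_ + _); apply: eq_bigr => k _; rewrite mulrA.
by rewrite divr_ge0// ltW.
Qed.

End immigration.
End expansions.

(** * The limit law *)

Lemma limit_law_exists (R : realType) (nu : R) (K : nat) (lambda : nat -> R) :
  0 <= nu -> (forall i, (0 < i)%N -> 0 <= jump_rate K lambda i) ->
  exists (d' : measure_display) (T' : measurableType d') (P : probability T' R)
    (Y : {RV P >-> nat}),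
    compound_poisson P Y /\
    forall s : R, 0 <= s <= 1 -> pgf P Y s = (limit_pgf nu K lambda s)%:E.
Proof.
move=> nu0 b0.
pose L := log_limit_pgf nu K lambda; pose tau := log_coef nu K lambda.
have tau0 k : 0 <= tau k by exact: log_coef_ge0.
have tau_cvg (s : R) : 0 <= s <= 1 ->
    series (fun k => tau k * s ^+ k) @ \oo --> L (1 - s) - L 1.
  by move=> s01; exact: log_limit_pgf_series.
(* The rate is -log G(0), and the jump law is [tau / rate], so that G = exp(rate * (g - 1)). *)
pose rate := - L 1.
have z1 : 0 <= (1 : R) <= 1 by rewrite lexx ler01.
have tau_sum : series tau @ \oo --> rate.
  have := tau_cvg 1 z1; rewrite subrr /L log_limit_pgf0 sub0r.
  by under eq_fun do rewrite expr1n mulr1.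
have rate0 : 0 <= rate.
  by apply: (cvgr_to_ge tau_sum); apply: nearW => n; rewrite /series/= sumr_ge0.
(* At rate 0 no jump occurs, and the Dirac mass at 0 serves as a placeholder law; below, all [tau k]
   are then 0 and G is 1. *)
pose p k := if rate == 0 then (k == 0%N)%:R else tau k / rate.
pose g s := if rate == 0 then 1 else (L (1 - s) + rate) / rate.
have p_ge0 k : 0 <= p k by rewrite /p; case: ifP => // _; rewrite divr_ge0.
have p_pgf (s : R) : 0 <= s <= 1 -> series (fun k => p k * s ^+ k) @ \oo --> g s.
  move=> s01; rewrite /p /g; case: eqP => [_|/eqP r0].
    rewrite -(cvg_shiftS _); apply: cvg_near_cst; apply: nearW => n.
    rewrite /series/= big_nat_recl// mul1r expr0 big1 ?addr0// => i _.
    by rewrite mul0r.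
  rewrite (_ : series _ = (fun n => series (fun k => tau k * s ^+ k) n / rate)).
    by apply: cvgMr_tmp; rewrite /rate; exact: tau_cvg.
  apply/funext => n; rewrite /series/= mulr_suml; apply: eq_bigr => k _.
  by rewrite mulrAC.
have p_sum1 : series p @ \oo --> (1 : R).
  have := p_pgf 1 z1; under eq_fun do rewrite expr1n mulr1.
  rewrite /g subrr {1}/L log_limit_pgf0 add0r; case: eqP => // /eqP r0.
  by rewrite divff.
have [d' [T' [P [Y [cP pP]]]]] := compound_poisson_exists rate0 p_ge0 p_sum1 p_pgf.
exists d', T', P, Y; split => // s s01; rewrite pP// limit_pgfE; congr (expR _)%:E.
rewrite /g; case: eqP => [r0|/eqP r0]; last by rewrite mulrC divfK// addrK.
have tau_eq0 k : tau k = 0.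
  apply/eqP; rewrite eq_le tau0 andbT.
  have : series tau k.+1 <= rate.
    apply: (cvgr_to_ge tau_sum); exists k.+1 => // n /= kn.
    by rewrite /series/= (@big_cat_nat _ _ _ k.+1 0 n)//= lerDl sumr_ge0.
  rewrite r0 /series/= big_nat_recr//=; apply: le_trans.
  by rewrite lerDr sumr_ge0.
have := tau_cvg s s01.
rewrite (_ : series _ = fun=> 0).
  move=> /(cvg_lim (@Rhausdorff R)); rewrite lim_cst//.
  by rewrite -/L r0 mul0r subrr -[L 1]opprK -/rate r0 oppr0 subr0.
apply/funext => n; rewrite /series/= big1// => k _.
by rewrite tau_eq0 mul0r.
Qed.

(** * Convergence in distribution from convergence of point masses *)

Lemma expectation_affine d (T : measurableType d) (R : realType) (P : probability T R)
    (X : T -> R) (r c b : R) :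
  measurable_fun setT X -> (forall w, 0 <= X w <= 1) ->
  ('E_P[X] = r%:E)%E -> ('E_P[fun w => (c * X w - b)%R] = (c * r - b)%:E)%E.
Proof.
move=> mX X01; rewrite expectation.unlock => Er.
have iX : P.-integrable setT (EFin \o X).
  apply/integrableP; split; first exact/measurable_EFinP.
  under eq_integral do rewrite /= ger0_norm ?(andP (X01 _)).1//.
  by rewrite Er ltry.
have icX : P.-integrable setT (EFin \o (fun w => c * X w)).
  exact: (integrableZl _ c iX).
have ib : P.-integrable setT (EFin \o cst b).
  exact: finite_measure_integrable_cst.
transitivity (\int[P]_w ((EFin \o (fun w => c * X w)%R) w - (EFin \o cst b) w))%E.
  by apply: eq_integral => w _; rewrite /= EFinB.
rewrite (integralB measurableT icX ib).
have -> : (\int[P]_w (EFin \o (fun w => c * X w)%R) w = c%:E * r%:E)%E.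
  by rewrite -Er -(integralZl measurableT iX).
have PT : P setT = 1%E := probability_setT P.
have -> : (\int[P]_w (EFin \o cst b) w = b%:E * P setT)%E.
  exact: (integral_cst P measurableT b%:E).
by rewrite PT mule1 EFinB EFinM.
Qed.

Lemma nat_cvg_in_distribution d (T : measurableType d) d' (T' : measurableType d')
    (R : realType) (P : probability T R) (P' : probability T' R)
    (X : nat -> T -> nat) (Y : T' -> nat) :
  (forall n, measurable_fun setT (X n)) -> measurable_fun setT Y ->
  (forall k, nat_pmf P (X n) k @[n --> \oo] --> nat_pmf P' Y k) ->
  cvg_in_distribution P P' (fun n w => (X n w)%:R) (fun w => (Y w)%:R).
Proof.
move=> mX mY pcvg g _ [M0 [_ HM0]].
pose M := `|M0| + 1.
have M_gt0 : 0 < M by rewrite ltr_wpDl.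
have gM (x : R) : `|g x| <= M.
  by apply: (HM0 M) => //; rewrite (le_lt_trans (ler_norm _))// ltrDl.
(* Rescaling to [0, 1] makes [weighted_mean_cvg] applicable; the affine map is undone at the end. *)
pose u k := (g k%:R + M) / (2 * M).
have u01 k : 0 <= u k <= 1.
  have := gM k%:R; rewrite ler_norml => /andP[g1 g2].
  rewrite /u divr_ge0 ?ler_pdivrMr ?mulr_gt0 ?mul1r//=.
  - by rewrite mulrDl mul1r lerD2r.
  - by rewrite -lerBlDr sub0r.
  - by rewrite mulr_ge0// ltW.
have uE d0 (T0 : measurableType d0) (P0 : probability T0 R) (Z : T0 -> nat) :
    measurable_fun setT Z -> exists r, [/\ ('E_P0[fun w => g (Z w)%:R] = (2 * M * r - M)%:E)%E &
      series (fun k => nat_pmf P0 Z k * u k) @ \oo --> r].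
  move=> mZ; have mu := measurable_real_comp u mZ.
  have [r _ Er] := @expectation_unit _ _ _ P0 _ mu (fun w => u01 (Z w)).
  exists r; split.
    rewrite -(expectation_affine (2 * M) M mu _ Er); last by move=> w; exact: u01.
    congr expectation; apply/funext => w; rewrite /u.
    by field; rewrite gt_eqF.
  by apply: nat_pmf_series => // k; case/andP: (u01 k).
have [U' [-> U'cvg]] := uE _ _ P' Y mY.
pose U n := sval (cid (uE _ _ P (X n) (mX n))).
have UE n : ('E_P[fun w => g (X n w)%:R] = (2 * M * U n - M)%:E)%E.
  by have [] := svalP (cid (uE _ _ P (X n) (mX n))).
have Ucvg n : series (fun k => nat_pmf P (X n) k * u k) @ \oo --> U n.
  by have [] := svalP (cid (uE _ _ P (X n) (mX n))).
under eq_fun do rewrite UE.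
apply: cvg_EFin; first exact: nearW.
rewrite /=; apply: cvgB; last exact: cvg_cst.
apply: cvgMl_tmp.
apply: (@weighted_mean_cvg R (fun n => nat_pmf P (X n)) (nat_pmf P' Y) u) => //.
- by move=> n; exact: nat_pmf_subprobability.
- exact: nat_pmf_subprobability.
- exact: nat_pmf_series1.
Qed.

(** No moment is assumed: with [m] catching mass 1 - e / 2, E (1 - x)^Z >= (1 - x)^m P(Z < m), and
    Bernoulli's inequality bounds the power below by 1 - m x. The [m.+1] in [delta] avoids dividing
    by 0. *)
Lemma rv_pgf_right d (T : measurableType d) (R : realType) (P : probability T R)
    (Z : T -> nat) (e : R) : measurable_fun setT Z -> 0 < e ->
  exists2 delta : R, 0 < delta & forall x : R, 0 <= x <= 1 -> x <= delta ->
    1 - rv_pgf P Z (1 - x) <= e.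
Proof.
move=> mZ e0; have e20 : 0 < e / 2 by rewrite divr_gt0.
have /cvgrPdist_le/(_ _ e20)[m _ Hm] := nat_pmf_series1 P mZ.
have := Hm m (leqnn m); rewrite /= => {}Hm.
have {}Hm : 1 - e / 2 <= series (nat_pmf P Z) m.
  by move: Hm; rewrite ler_norml => /andP[_]; lra.
exists (e / 2 / m.+1%:R); first by rewrite divr_gt0.
move=> x x01 xd; have /andP[x0 x1] := x01.
have y01 : 0 <= 1 - x <= 1 by rewrite subr_ge0 x1 gerBl.
have y0 : 0 <= 1 - x by case/andP: y01.
have y1 : 1 - x <= 1 by case/andP: y01.
have pcvg : series (fun k => nat_pmf P Z k * (1 - x) ^+ k) @ \oo --> rv_pgf P Z (1 - x).
  apply: (nat_pmf_series mZ (u := GRing.exp (1 - x))); first by move=> k; rewrite exprn_ge0.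
  exact: (rv_pgfE P mZ y01).1.
have pow0 k : 0 <= (1 - x) ^+ k by rewrite exprn_ge0.
have pow1 k : (0 <= k)%N -> (1 - x) ^+ k <= 1 by rewrite exprn_ile1.
have [p0 p1] := nat_pmf_subprobability P mZ.
have low : (1 - x) ^+ m * series (nat_pmf P Z) m <= rv_pgf P Z (1 - x).
  apply: (@le_trans _ _ (\sum_(0 <= k < m) nat_pmf P Z k * (1 - x) ^+ k)).
    rewrite /series/= mulr_sumr; apply: ler_sum_nat => k /andP[_ km].
    by rewrite mulrC ler_wpM2l// ler_wiXn2l// ltnW.
  apply: (cvgr_to_ge pcvg); exists m => // n /= mn.
  rewrite /series/= (@big_cat_nat _ _ _ m 0 n)//= lerDl sumr_ge0// => k _.
  by rewrite mulr_ge0.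
have bern : 1 - m%:R * x <= (1 - x) ^+ m.
  have := bonferroni_norm m 1 x01; rewrite big_nat1 !expr0 bin0 bin1 !mulr1 expr1.
  by rewrite ler_norml => /andP[h _]; lra.
have mx : m%:R * x <= e / 2.
  move: xd; rewrite ler_pdivlMr// mulrC; apply: le_trans.
  by rewrite ler_wpM2r// ler_nat.
have s1 : series (nat_pmf P Z) m <= 1 by exact: p1.
have s0 : 0 <= series (nat_pmf P Z) m by rewrite /series/= sumr_ge0.
have m1 := pow1 m isT.
have : 1 - (1 - x) ^+ m * series (nat_pmf P Z) m <=
  (1 - (1 - x) ^+ m) + (1 - series (nat_pmf P Z) m).
  rewrite -subr_ge0 (_ : _ - _ = (1 - (1 - x) ^+ m) * (1 - series (nat_pmf P Z) m)).
    by rewrite mulr_ge0// subr_ge0.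
  by ring.
lra.
Qed.

Theorem theorem2 (R : realType) (d : measure_display) (T : measurableType d)
  (P : probability T R)
  (* xi0 n is the generic offspring variable xi_(n+1), and xi n j, eps n are
     xi_(n+1, j+1), epsilon_(n+1) *)
  (xi0 : nat -> {RV P >-> nat}) (xi : nat -> nat -> {RV P >-> nat})
  (eps : nat -> {RV P >-> nat})
  (indep : mutually_independent (offspring_immigration xi eps))
  (ident : forall n j, same_law P P (xi n j) (xi0 n))
  (C1_lt1 : forall n, (mean P (xi0 n) < 1)%E)
  (C1_lim : mean P (xi0 n) @[n --> \oo] --> 1%E)
  (C1_sum : (\sum_(0 <= n <oo) (1 - mean P (xi0 n)) = +oo)%E)
  (nu : R) (nu_ge0 : 0 <= nu)
  (C2 : (factorial_moment P (xi0 n) 2 / (1 - mean P (xi0 n)))%E @[n --> \oo] --> nu%:E)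
  (C3 : 0 < nu ->
    (factorial_moment P (xi0 n) 3 / (1 - mean P (xi0 n)))%E @[n --> \oo] --> 0%E)
  (K : nat) (K_gt0 : (0 < K)%N) (lambda : nat -> R)
  (lambda_ge0 : forall k, (1 <= k <= K)%N -> 0 <= lambda k)
  (immigration : forall k, (1 <= k <= K)%N ->
    (factorial_moment P (eps n) k / ((k`!)%:R%:E * (1 - mean P (xi0 n))))%E
      @[n --> \oo] --> (lambda k)%:E)
  (lambda_K : lambda K = 0) :
  exists (d' : measure_display) (T' : measurableType d')
    (P' : probability T' R) (Y : {RV P' >-> nat}),
    [/\ cvg_in_distribution P P'
          (fun n w => (gw_process xi eps n w)%:R) (fun w => (Y w)%:R),
        compound_poisson P' Y
      & forall s : R, 0 <= s <= 1 -> pgf P' Y s = (limit_pgf nu K lambda s)%:E].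
Proof.
have mX n : measurable_fun setT (xi0 n : T -> nat) := measurable_funPT (xi0 n).
have mE n : measurable_fun setT (eps n : T -> nat) := measurable_funPT (eps n).
pose a n := 1 - fine (mean P (xi0 n)).
have mean_ge0 n : (0 <= mean P (xi0 n))%E.
  by rewrite mean_factorial_moment; exact: factorial_moment_ge0.
have mean_fin n : mean P (xi0 n) \is a fin_num.
  by rewrite ge0_fin_numE// (lt_trans (C1_lt1 n))// ltry.
have meanE n : mean P (xi0 n) = (1 - a n)%:E by rewrite /a subKr fineK.
have a_gt0 n : 0 < a n.
  by have := C1_lt1 n; rewrite meanE lte_fin; lra.
have a_le1 n : a n <= 1.
  by have := mean_ge0 n; rewrite meanE lee_fin; lra.
have a_cvg0 : a @ \oo --> (0 : R).
  have : fine (mean P (xi0 n)) @[n --> \oo] --> (1 : R) by exact: (fine_cvg C1_lim).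
  move=> h; have : a @ \oo --> (1 - 1 : R) by apply: cvgB => //; exact: cvg_cst.
  by rewrite subrr.
have a_sum : series a @ \oo --> +oo.
  have mean' n : (1 - mean P (xi0 n) = (a n)%:E)%E.
    by rewrite meanE -EFinB subKr.
  have a_sum : (\sum_(0 <= n <oo) (a n)%:E = +oo)%E.
    by rewrite -C1_sum; apply: eq_eseriesr => n _; rewrite mean'.
  have : (\sum_(0 <= k < n) (a k)%:E)%E @[n --> \oo] --> +oo%E.
    by rewrite -a_sum; apply: is_cvg_nneseries => n _ _; rewrite lee_fin ltW.
  by under eq_fun do rewrite sumEFin; move/cvgeryP.
(* The immigration law enters the construction of the limit only through the signs of these
   rates. *)
have b0 := limit_jump_rate_ge0 a_gt0 meanE K_gt0 immigration lambda_K.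
have [d' [T' [P' [Y [cP pP]]]]] := limit_law_exists nu_ge0 b0.
exists d', T', P', Y; split => //.
pose phi n (x : R) := 1 - rv_pgf P (xi0 n) (1 - x).
pose eta n (x : R) := rv_pgf P (eps n) (1 - x).
pose G n (x : R) := rv_pgf P (gw_process xi eps n) (1 - x).
have compl01 (x : R) : 0 <= x <= 1 -> 0 <= 1 - x <= 1.
  by move=> /andP[x0 x1]; rewrite subr_ge0 x1 gerBl.
have phi_ge0 n (x : R) : 0 <= x <= 1 -> 0 <= phi n x.
  by move=> /compl01 /(rv_pgfE P (mX n))[_ /andP[_]]; rewrite subr_ge0.
have phi_le n (x : R) : 0 <= x <= 1 -> phi n x <= (1 - a n) * x.
  exact: offspring_mean_bound.
have eta01 n (x : R) : 0 <= x <= 1 -> 0 <= eta n x <= 1.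
  by move=> /compl01 /(rv_pgfE P (mE n))[].
have mY n := measurable_gw_process xi eps n.
have G01 n (x : R) : 0 <= x <= 1 -> 0 <= G n x <= 1.
  by move=> /compl01 /(rv_pgfE P (mY n))[].
have GS n (x : R) : 0 <= x <= 1 -> G n.+1 x = G n (phi n x) * eta n x.
  move=> /compl01 x01; rewrite /G (gw_pgf_rec indep ident)//.
  by rewrite /phi subKr.
have G_right n (e : R) : 0 < e -> exists2 delta : R, 0 < delta &
    forall x : R, 0 <= x <= 1 -> x <= delta -> 1 - G n x <= e.
  exact: rv_pgf_right.
have err := one_step_error nu_ge0 a_gt0 a_le1 phi_ge0 phi_le a_cvg0
  (offspring_expansion a_gt0 meanE nu_ge0 C2 C3)
  (immigration_expansion a_gt0 meanE K_gt0 immigration lambda_K).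
have unif := contraction nu_ge0 a_gt0 a_le1 phi_ge0 phi_le GS eta01 G01 G_right a_sum err.
have GY (s : R) : 0 <= s <= 1 -> rv_pgf P' Y s = limit_pgf nu K lambda s.
  move=> s01; apply: EFin_inj; rewrite -pP//.
  exact/esym/(rv_pgfE P' (measurable_funPT Y) s01).1.
apply: nat_cvg_in_distribution => // k.
have series_rv d0 (T0 : measurableType d0) (P0 : probability T0 R) (Z : T0 -> nat) (s : R) :
    measurable_fun setT Z -> 0 <= s <= 1 ->
    series (fun k => nat_pmf P0 Z k * s ^+ k) @ \oo --> rv_pgf P0 Z s.
  move=> mZ s01; have /andP[s0 s1] := s01.
  apply: (nat_pmf_series mZ (u := GRing.exp s)); first by move=> m; rewrite exprn_ge0.
  exact: (rv_pgfE P0 mZ s01).1.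
apply: (@pgf_coef_cvg R (fun n => nat_pmf P (gw_process xi eps n)) (nat_pmf P' Y)
  (fun n s => rv_pgf P (gw_process xi eps n) s) (rv_pgf P' Y)).
- by move=> n; exact: nat_pmf_subprobability.
- exact: nat_pmf_subprobability.
- by move=> n s; exact: series_rv.
- by move=> s; exact: series_rv.
(* The uniform estimate in x = 1 - s is needed only pointwise from here on. *)
- move=> s s01; rewrite GY// limit_pgfE.
  apply/cvgrPdistC_le => e e0; apply: filterS (unif e e0) => n.
  by move=> /(_ (1 - s) (compl01 s s01)); rewrite /G subKr.
Qed.
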